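(* Let $\sigma$ be a germ of holomorphic map of $(\mathbb C^{2p},0)$ with linear part $\hat S\colon\xi_j'=\mu_j\xi_j,\ \eta_j'=\mu_j^{-1}\eta_j$ $(1\le j\le p)$, whose eigenvalues satisfy the non-resonance condition $\mu^Q\ne1$ for all $Q\in\mathbb Z^p\setminus\{0\}$. Suppose that $\sigma=\tau_1\tau_2$, where $\tau_1$ is a holomorphic involution, $\rho_0$ is an anti-holomorphic involution, and $\tau_2=\rho_0\tau_1\rho_0$. Then there exists a formal (invertible) map $\Psi$ such that $\Psi^{-1}\rho_0\Psi=\rho$ is the standard involution given in the context, and $\sigma^*=\Psi^{-1}\sigma\Psi$, $\tau_i^*=\Psi^{-1}\tau_i\Psi$ $(i=1,2)$ have the form $$\sigma^*\colon\ \xi_j'=M_j(\xi\eta)\xi_j,\quad \eta_j'=M_j^{-1}(\xi\eta)\eta_j,\quad M_j(0)=\mu_j,$$ $$\tau_i^*\colon\ \xi_j'=\Lambda_{ij}(\xi\eta)\eta_j,\quad \eta_j'=\Lambda_{ij}^{-1}(\xi\eta)\xi_j,\qquad 1\le j\le p .$$ Assume further that $\log M$ is tangent to the identity at the origin. Then, under a further formal change of coordinates that preserves $\rho$, $\sigma^*$ and $\tau_i^*$ are transformed into $$\hat\sigma\colon\ \xi_j'=\hat M_j(\xi\eta)\xi_j,\quad \eta_j'=\hat M_j^{-1}(\xi\eta)\eta_j,\quad \hat M_j(0)=\mu_j,$$ $$\hat\tau_i\colon\ \xi_j'=\hat\Lambda_{ij}(\xi\eta)\eta_j,\quad \eta_j'=\hat\Lambda_{ij}^{-1}(\xi\eta)\xi_j,\quad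 \hat\Lambda_{2j}=\hat\Lambda_{1j}^{-1},\qquad 1\le j\le p,$$ where $\log\hat M(\zeta)-\zeta=O(|\zeta|^2)$ and its $j$th component is independent of $\zeta_j$ for each $j$. Moreover, $\hat M$ is unique.
   Context: Notation: $(\xi,\eta)\in\mathbb C^p\times\mathbb C^p$, $\xi\eta=(\xi_1\eta_1,\dots,\xi_p\eta_p)$; $M_j,\Lambda_{ij},\hat M_j,\hat\Lambda_{ij}$ are formal power series in $p$ variables. Write $p=e_*+h_*+2s_*$, with index ranges $1\le e\le e_*$, $e_*<h\le e_*+h_*$, $e_*+h_*<s\le p-s_*$. The eigenvalues are labelled so that $\mu_j=\lambda_j^2$ with $\lambda_e>1$, $|\lambda_h|=1$, $|\lambda_s|>1$, $\lambda_{s+s_*}=\overline{\lambda_s}^{-1}$. The standard anti-holomorphic involution $\rho$ is $$\xi_e'=\bar\eta_e,\ \eta_e'=\bar\xi_e;\quad \xi_h'=\bar\xi_h,\ \eta_h'=\bar\eta_h;\quad \xi_s'=\bar\xi_{s+s_*},\ \xi_{s+s_*}'=\bar\xi_s,\ \eta_s'=\bar\eta_{s+s_*},\ \eta_{s+s_*}'=\bar\eta_s .$$ For $M=(M_1,\dots,M_p)$ with $M_j(0)\neq0$, the formal map $\log M$ of $(\mathbb C^p,0)$ is defined by $(\log M)_j(\zeta)=\log(M_j(\zeta)/M_j(0))$ for $1\le j\le e_*$ and $(\log M)_j(\zeta)=-i\log(M_j(\zeta)/M_j(0))$ for $e_*<j\le p$. *)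

(* Defs.v *)
From HB Require Import structures.
From mathcomp Require Import all_boot all_order all_algebra.
From mathcomp Require Import boolp reals complex.
From mathcomp Require Import mpoly.

Set Implicit Arguments.
Unset Strict Implicit.
Unset Printing Implicit Defensive.

Import Order.TTheory GRing.Theory Num.Theory.
Local Open Scope ring_scope.

Record fps (K : fieldType) (n : nat) := FPS { fcoef :> 'X_{1..n} -> K }.
Arguments FPS {K n} fcoef.

Section FpsRing.
Variables (K : fieldType) (n : nat).
Implicit Types (F G H : fps K n) (m : 'X_{1..n}).

Lemma fpsP F G : (forall m, F m = G m) -> F = G.
Proof. by case: F G => [f] [g] /= /funext->. Qed.

HB.instance Definition _ := gen_eqMixin (fps K n).
HB.instance Definition _ := gen_choiceMixin (fps K n).

Definition fzero : fps K n := FPS (fun=> 0).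
Definition fopp F : fps K n := FPS (fun m => - F m).
Definition fadd F G : fps K n := FPS (fun m => F m + G m).
Definition fone : fps K n := FPS (fun m => (m == 0%MM)%:R).
Definition fscale (c : K) F : fps K n := FPS (fun m => c * F m).
Definition fmul F G : fps K n := FPS (fun m =>
  \sum_(k : 'X_{1..n < (mdeg m).+1, (mdeg m).+1} | m == (k.1 + k.2)%MM)
     F k.1 * G k.2).

Fact faddA : associative fadd.
Proof. by move=> F G H; apply: fpsP => m /=; rewrite addrA. Qed.
Fact faddC : commutative fadd.
Proof. by move=> F G; apply: fpsP => m /=; rewrite addrC. Qed.
Fact fadd0 : left_id fzero fadd.
Proof. by move=> F; apply: fpsP => m /=; rewrite add0r. Qed.
Fact faddN : left_inverse fzero fopp fadd.
Proof. by move=> F; apply: fpsP => m /=; rewrite addNr. Qed.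

HB.instance Definition _ :=
  GRing.isZmodule.Build (fps K n) faddA faddC fadd0 faddN.

Definition ftrunc (d : nat) F : {mpoly K[n]} :=
  \sum_(k : 'X_{1..n < d}) F k *: 'X_[k].

Lemma mcoeff_ftrunc d F m : (mdeg m < d)%N -> (ftrunc d F)@_m = F m.
Proof.
move=> lt; rewrite /ftrunc.
have /= := mcoeff_mpoly F; by apply.
Qed.

Lemma fmul_coef_eq F G (p q : {mpoly K[n]}) d m : (mdeg m < d)%N ->
  (forall k, (mdeg k < d)%N -> F k = p@_k) ->
  (forall k, (mdeg k < d)%N -> G k = q@_k) ->
  fmul F G m = (p * q)@_m.
Proof.
move=> md eF eG; rewrite mcoeffM /=.
by apply: eq_bigr => k _; rewrite eF ?eG // (leq_trans _ md) // bmdeg.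
Qed.

Lemma fmul_ftrunc d F G m : (mdeg m < d)%N ->
  fmul F G m = (ftrunc d F * ftrunc d G)@_m.
Proof.
by move=> md; apply: (fmul_coef_eq md) => k kd; rewrite mcoeff_ftrunc.
Qed.

Fact fmulA : associative fmul.
Proof.
move=> F G H; apply: fpsP => m; set d := (mdeg m).+1.
rewrite (@fmul_coef_eq _ _ (ftrunc d F) (ftrunc d G * ftrunc d H) d) //.
- rewrite (@fmul_coef_eq _ _ (ftrunc d F * ftrunc d G) (ftrunc d H) d) //.
  + by rewrite mulrA.
  + by move=> k kd; rewrite (fmul_ftrunc _ _ kd).
  + by move=> k kd; rewrite mcoeff_ftrunc.
- by move=> k kd; rewrite mcoeff_ftrunc.
- by move=> k kd; rewrite (fmul_ftrunc _ _ kd).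
Qed.

Fact fmulC : commutative fmul.
Proof.
by move=> F G; apply: fpsP => m; rewrite !(fmul_ftrunc _ _ (ltnSn _)) mulrC.
Qed.

Fact fmul1 : left_id fone fmul.
Proof.
move=> F; apply: fpsP => m; set d := (mdeg m).+1.
rewrite (@fmul_coef_eq _ _ 1 (ftrunc d F) d) ?mul1r ?mcoeff_ftrunc //.
- by move=> k _; rewrite mcoeff1.
- by move=> k kd; rewrite mcoeff_ftrunc.
Qed.

Fact fmulDl : left_distributive fmul fadd.
Proof.
move=> F G H; apply: fpsP => m /=; rewrite -big_split /=.
by apply: eq_bigr => k _; rewrite mulrDl.
Qed.

Fact fone_neq0 : fone != 0.
Proof.
apply/eqP => /(congr1 (fun F : fps K n => F 0%MM)) /= /eqP.
by rewrite eqxx oner_eq0.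
Qed.

HB.instance Definition _ := GRing.Zmodule_isComNzRing.Build (fps K n)
  fmulA fmulC fmul1 fmulDl fone_neq0.

Fact fscaleA a b F : fscale a (fscale b F) = fscale (a * b) F.
Proof. by apply: fpsP => m /=; rewrite mulrA. Qed.
Fact fscale1 : left_id 1 fscale.
Proof. by move=> F; apply: fpsP => m /=; rewrite mul1r. Qed.
Fact fscaleDr : right_distributive fscale +%R.
Proof. by move=> a F G; apply: fpsP => m /=; rewrite mulrDr. Qed.
Fact fscaleDl F : {morph fscale^~ F : a b / a + b}.
Proof. by move=> a b; apply: fpsP => m /=; rewrite mulrDl. Qed.

HB.instance Definition _ := GRing.Zmodule_isLmodule.Build K (fps K n)
  fscaleA fscale1 fscaleDr fscaleDl.

Fact fscaleAl (a : K) F G : a *: (F * G) = (a *: F) * G.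
Proof.
apply: fpsP => m /=; rewrite big_distrr /=.
by apply: eq_bigr => k _; rewrite mulrA.
Qed.

HB.instance Definition _ := GRing.Lmodule_isLalgebra.Build K (fps K n) fscaleAl.
HB.instance Definition _ := GRing.Lalgebra_isComAlgebra.Build K (fps K n).

Lemma fpsD F G m : (F + G) m = F m + G m. Proof. by []. Qed.
Lemma fpsN F m : (- F) m = - F m. Proof. by []. Qed.
Lemma fpsZ c F m : (c *: F) m = c * F m. Proof. by []. Qed.
Lemma fps0 m : (0 : fps K n) m = 0. Proof. by []. Qed.
Lemma fps1 m : (1 : fps K n) m = (m == 0%MM)%:R. Proof. by []. Qed.

Lemma fps_sum (I : Type) (r : seq I) (P : pred I) (E : I -> fps K n) m :
  (\sum_(i <- r | P i) E i) m = \sum_(i <- r | P i) E i m.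
Proof.
by elim/big_rec2: _ => // i x y _ <-.
Qed.

Lemma fpsM_eq F F' G G' m :
  (forall k, (mdeg k <= mdeg m)%N -> F k = F' k) ->
  (forall k, (mdeg k <= mdeg m)%N -> G k = G' k) -> (F * G) m = (F' * G') m.
Proof.
move=> eF eG /=; apply: eq_bigr => k _.
by rewrite eF ?eG // -ltnS bmdeg.
Qed.

Lemma fpsM0 F G : (F * G) 0%MM = F 0%MM * G 0%MM.
Proof.
rewrite [LHS](@fmul_ftrunc 1) ?mdeg0 //.
by rewrite rmorphM /= !mcoeff_ftrunc ?mdeg0.
Qed.

Lemma fpsX_small F k m : F 0%MM = 0 -> (mdeg m < k)%N -> (F ^+ k) m = 0.
Proof.
move=> F0; elim: k m => // k IH m lt.
rewrite exprS /= big1 // => -[k1 k2] /= /eqP em.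
have [k10|k1n0] := eqVneq (bmnm k1) 0%MM; first by rewrite k10 F0 mul0r.
rewrite IH ?mulr0 //; have := congr1 (@mdeg n) em; rewrite mdegD => dm.
move: lt; rewrite ltnS => /(leq_trans _); apply.
by rewrite [X in (_ <= X)%N]dm -add1n leq_add2r lt0n mdeg_eq0.
Qed.

(* The geometric series for 1 / F when F(0) != 0.                             *)
Definition finv F : fps K n :=
  if F 0%MM == 0 then F else
  FPS (fun m => (F 0%MM)^-1 *
    (\sum_(k < (mdeg m).+1) (1 - (F 0%MM)^-1 *: F) ^+ k) m).

Definition funit : {pred fps K n} := fun F => F 0%MM != 0.

Fact fmulV : {in funit, left_inverse 1 finv *%R}.
Proof.
move=> F; rewrite unfold_in => F0; apply: fpsP => m.
set c := F 0%MM; set N := 1 - c^-1 *: F; set S := \sum_(k < (mdeg m).+1) N ^+ k.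
have N0 : N 0%MM = 0 by rewrite fpsD fpsN fpsZ fps1 eqxx mulVf // subrr.
have eF : F = c *: (1 - N) by rewrite opprB addrC subrK scalerA mulfV ?scale1r.
have -> : (finv F * F) m = (c^-1 *: S * F) m.
  apply: fpsM_eq => // k km; rewrite /finv (negPf F0) fpsZ /=; congr (_ * _).
  rewrite !fps_sum -(big_mkord xpredT (fun i => (N ^+ i) k)).
  rewrite -(big_mkord xpredT (fun i => (N ^+ i) k)).
  rewrite [RHS](big_cat_nat (n := (mdeg k).+1)) //= [X in _ = _ + X]big_nat_cond.
  rewrite [X in _ = _ + X]big1 ?addr0 // => i /andP[/andP[ki _] _].
  exact: fpsX_small.
rewrite [X in _ * X]eF -scalerAl -scalerAr scalerA mulVf // scale1r mulrC.
by rewrite -opprB mulNr -subrX1 opprB fpsD fpsN fpsX_small // subr0.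
Qed.

Fact funitPl F G : G * F = 1 -> funit F.
Proof.
move=> /(congr1 (fun H : fps K n => H 0%MM)); rewrite fpsM0 fps1 eqxx => e.
by apply/eqP => F0; move/eqP: e; rewrite F0 mulr0 eq_sym oner_eq0.
Qed.

Fact finv_out : {in [predC funit], finv =1 id}.
Proof. by move=> F; rewrite inE unfold_in negbK /finv => ->. Qed.

HB.instance Definition _ := GRing.ComNzRing_hasMulInverse.Build (fps K n)
  fmulV funitPl finv_out.

End FpsRing.

Definition fX (K : fieldType) (n : nat) (i : 'I_n) : fps K n :=
  FPS (fun m => (m == U_(i)%MM)%:R).
Arguments fX {K n} i.

(* Substitution F(G_1, ..., G_n).  It is only meaningful when G_i(0) = 0, in  *)
(* which case monomials of F of degree larger than |m| do not contribute to   *)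
(* the coefficient of m.                                                      *)
Definition fcomp (K : fieldType) (n q : nat) (F : fps K n)
    (G : 'I_n -> fps K q) : fps K q :=
  FPS (fun m => \sum_(k : 'X_{1..n < (mdeg m).+1})
                  F k * (\prod_i G i ^+ k i) m).

(* log U = sum_(k >= 1) (-1)^(k+1) (U - 1)^k / k, for U(0) = 1.               *)
Definition flog (K : fieldType) (n : nat) (U : fps K n) : fps K n :=
  FPS (fun m => \sum_(1 <= k < (mdeg m).+1)
                  (-1) ^+ k.+1 / k%:R * ((U - 1) ^+ k) m).

Section FormalMaps.
Variable C : numClosedFieldType.

Definition fconj (n : nat) (F : fps C n) : fps C n := FPS (fun m => (F m)^*).

(* Absolute convergence on the polydisc of radius r (0 < r makes r real).     *)
Definition convergent (n : nat) (F : fps C n) : Prop :=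
  exists r B : C, 0 < r /\
    forall d, \sum_(k : 'X_{1..n < d}) `|F k| * r ^+ mdeg k <= B.

(* A formal self-map of (C^n, 0): [FMap false F] is z |-> F(z), and           *)
(* [FMap true F] is the anti-holomorphic map z |-> F(z^* ).                   *)
Record fmap (n : nat) := FMap { antihol : bool; comps : 'I_n -> fps C n }.

Definition fixes0 (n : nat) (f : fmap n) : Prop :=
  forall i, comps f i 0%MM = 0.

(* Germs of (anti-)holomorphic maps of (C^n, 0) are convergent formal maps.   *)
Definition hol_germ (n : nat) (f : fmap n) : Prop :=
  [/\ antihol f = false, fixes0 f & forall i, convergent (comps f i)].

Definition antihol_germ (n : nat) (f : fmap n) : Prop :=
  [/\ antihol f = true, fixes0 f & forall i, convergent (comps f i)].

Definition idmap (n : nat) : fmap n := FMap false (fun i => fX i).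

(* f o g; when f(w) = F(w^* ), conjugating w = g(z) conjugates coefficients.  *)
Definition mcomp (n : nat) (f g : fmap n) : fmap n :=
  FMap (antihol f (+) antihol g)
    (fun i => fcomp (comps f i)
       (fun j => if antihol f then fconj (comps g j) else comps g j)).

Definition involution (n : nat) (f : fmap n) : Prop := mcomp f f = idmap n.

Definition inverse_maps (n : nat) (Psi Psi' : fmap n) : Prop :=
  [/\ antihol Psi = false /\ antihol Psi' = false,
      fixes0 Psi /\ fixes0 Psi',
      mcomp Psi Psi' = idmap n & mcomp Psi' Psi = idmap n].

(* Psi is an invertible formal map and Psi^-1 f Psi = g.                      *)
Definition conjugates (n : nat) (Psi f g : fmap n) : Prop :=
  exists Psi', inverse_maps Psi Psi' /\ mcomp Psi' (mcomp f Psi) = g.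

Definition linear_part (n : nat) (F : 'I_n -> fps C n) : 'M[C]_n :=
  \matrix_(i, j) F i U_(j)%MM.

Definition tangent_to_id (n : nat) (F : 'I_n -> fps C n) : Prop :=
  (forall i, F i 0%MM = 0) /\ linear_part F = 1%:M.

Definition nonresonant (p : nat) (mu : 'I_p -> C) : Prop :=
  forall Q : 'rV[int]_p, Q != 0 -> \prod_j mu j ^ Q 0 j != 1.

(* On C^(p + p) the coordinate xi_j has index [lshift p j], and eta_j has     *)
(* index [rshift p j].                                                        *)
Section XiEta.
Variable p : nat.

Definition xi (j : 'I_p) : fps C (p + p) := fX (lshift p j).
Definition eta (j : 'I_p) : fps C (p + p) := fX (rshift p j).

Definition xieta_map (a : bool) (X Y : 'I_p -> fps C (p + p)) : fmap (p + p) :=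
  FMap a (fun i => match split i with inl j => X j | inr j => Y j end).

Definition at_xieta (F : fps C p) : fps C (p + p) :=
  fcomp F (fun j => xi j * eta j).

Definition linS (mu : 'I_p -> C) : 'M[C]_(p + p) :=
  diag_mx (row_mx (\row_j mu j) (\row_j (mu j)^-1)).

Definition sigma_nf (M : 'I_p -> fps C p) : fmap (p + p) :=
  xieta_map false (fun j => at_xieta (M j) * xi j)
                  (fun j => at_xieta (M j)^-1 * eta j).

Definition tau_nf (L : 'I_p -> fps C p) : fmap (p + p) :=
  xieta_map false (fun j => at_xieta (L j) * eta j)
                  (fun j => at_xieta (L j)^-1 * xi j).

End XiEta.

(* Indices (from 0) j < es are those of type e, es <= j < es + hs of type h,  *)
(* and the remaining ss + ss ones are of type s, paired by s <-> s + ss.      *)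
Section Types.
Variables es hs ss : nat.
Local Notation p := (es + hs + (ss + ss))%N.

Definition eigen_labels (mu lambda : 'I_p -> C) : Prop :=
  [/\ forall j, mu j = lambda j ^+ 2,
      forall e : 'I_p, (e < es)%N -> 1 < lambda e,
      forall h : 'I_p, (es <= h < es + hs)%N -> `|lambda h| = 1,
      forall s : 'I_p, (es + hs <= s < es + hs + ss)%N -> 1 < `|lambda s|
    & forall s t : 'I_p, (es + hs <= s < es + hs + ss)%N ->
        t = (s + ss)%N :> nat -> lambda t = ((lambda s)^*)^-1].

Definition swap_s (j : 'I_p) : 'I_p :=
  match split j with
  | inl _ => j
  | inr k => match split k with
             | inl s => rshift (es + hs) (rshift ss s)
             | inr s => rshift (es + hs) (lshift ss s)
             end
  end.

Definition rho_std : fmap (p + p) :=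
  xieta_map true (fun j => if (j < es)%N then eta j else xi (swap_s j))
                 (fun j => if (j < es)%N then xi j else eta (swap_s j)).

Definition log_map (M : 'I_p -> fps C p) : 'I_p -> fps C p := fun j =>
  let l := flog ((M j 0%MM)^-1 *: M j) in if (j < es)%N then l else - 'i *: l.

Definition normal_form (mu : 'I_p -> C) (sigma tau1 tau2 rho0 : fmap (p + p))
    (Psi : fmap (p + p)) (M L1 L2 : 'I_p -> fps C p) : Prop :=
  [/\ conjugates Psi rho0 rho_std,
      conjugates Psi sigma (sigma_nf M),
      conjugates Psi tau1 (tau_nf L1),
      conjugates Psi tau2 (tau_nf L2)
    & forall j, [/\ M j 0%MM = mu j,
                    L1 j \is a GRing.unit & L2 j \is a GRing.unit]].

(* log M(zeta) - zeta = O(|zeta|^2), with j-th component independent of       *)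
(* zeta_j.                                                                    *)
Definition log_reduced (M : 'I_p -> fps C p) : Prop :=
  forall j, (forall m : 'X_{1..p}, (mdeg m < 2)%N ->
               (log_map M j - fX j) m = 0)
         /\ (forall m : 'X_{1..p}, m j != 0%N -> (log_map M j - fX j) m = 0).

Definition reduced_form (mu : 'I_p -> C) (M L1 L2 : 'I_p -> fps C p)
    (Phi : fmap (p + p)) (Mh Lh1 Lh2 : 'I_p -> fps C p) : Prop :=
  [/\ normal_form mu (sigma_nf M) (tau_nf L1) (tau_nf L2) rho_std
        Phi Mh Lh1 Lh2,
      forall j, Lh2 j = (Lh1 j)^-1
    & log_reduced Mh].

Definition reduced_from (mu : 'I_p -> C) (sigma tau1 tau2 rho0 : fmap (p + p))
    (Mh : 'I_p -> fps C p) : Prop :=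
  exists (Psi : fmap (p + p)) (M L1 L2 : 'I_p -> fps C p)
         (Phi : fmap (p + p)) (Lh1 Lh2 : 'I_p -> fps C p),
    [/\ normal_form mu sigma tau1 tau2 rho0 Psi M L1 L2,
        tangent_to_id (log_map M)
      & reduced_form mu M L1 L2 Phi Mh Lh1 Lh2].

End Types.
End FormalMaps.

Arguments rho_std {C} es hs ss.

(* Main.v *)
Require Import Defs.
From mathcomp Require Import all_boot all_order all_algebra.
From mathcomp Require Import boolp reals complex.
From mathcomp Require Import mpoly.
From mathcomp Require Import ring.

(** Why the theorem is true.

    Everything takes place in formal power series, truncated by degree. The
    only analytic tool is the Banach fixed point theorem for the degree metric,
    [contraction_fixpoint]: an operator that improves the agreement of two
    families by one degree has exactly one fixed point. It yields the formal
    inverse function theorem, the Poincare-Dulac theorem, square roots, and the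
    reduction of the invariants.

    Normal form. Poincare-Dulac conjugates [sigma] to a map [N] commuting with
    its linear part [S]. Since [sigma] is conjugate to its inverse by [tau_1],
    [tau_2] and [rho_0], the conjugates of these three maps intertwine [N] with
    [N^-1]. By [rigidity] they then intertwine [S] with [S^-1], and under
    nonresonance this determines their monomials: each component is a function
    of the invariants [zeta_j = xi_j eta_j] times one coordinate (the [toric]
    maps). Averaging turns the anti-holomorphic involution into the standard
    one, by a change of coordinates that commutes with [S]
    ([linearize_antihol]). Finally, a [tau_i] of this shape acts on [zeta] by
    an involution tangent to the identity, that is, trivially; hence its two
    coefficients are inverse to each other ([toric_swap_involution]), and those
    of [sigma = tau_1 tau_2] as well.

    Reduced form. The toric change of coordinates with coefficients [g_j] on
    [xi_j] and [g'_j] on [eta_j] transforms [M] into [M o phi], where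
    [phi_j = g_j g'_j zeta_j]. Writing [log M = zeta + f] and
    [phi = zeta + w], the reduced form requires
    that [w_j + f_j(zeta + w)] contain no monomial divisible by [zeta_j],
    while [w_j] contains only such monomials. This prescribes [w_j] as the
    opposite of the [zeta_j]-divisible part of [f_j(zeta + w)], a contraction
    ([flatten_contraction]). As [log M] is compatible with the involution
    induced by [rho] on functions of [zeta], uniqueness makes [phi] compatible
    as well. There remains to split [1 + w_j / zeta_j] as [g_j g'_j] so that
    [rho] is preserved and the product of the two [Lambda] becomes [1]; fourth
    roots of [Lambda_1 o phi] do this.

    Uniqueness. A map between two reduced forms is toric by [rigidity], and so
    acts on [zeta] by some [zeta + w] with [w_j] divisible by [zeta_j]. Since
    both [log M] and [log M o (zeta + w)] are reduced, [w] and [0] are fixed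
    points of the same contraction; hence [w = 0]. *)

Set Implicit Arguments.
Unset Strict Implicit.
Unset Printing Implicit Defensive.

Import Order.TTheory GRing.Theory Num.Theory.
Local Open Scope ring_scope.

(** * Truncation order and formal contractions *)

Section Order.
Variables (K : fieldType) (n : nat).
Implicit Types (F G H : fps K n) (m : 'X_{1..n}) (a b d e : nat).

Definition eqd d F G := forall m, (mdeg m < d)%N -> F m = G m.
Definition ord d F := forall m, (mdeg m < d)%N -> F m = 0.

Lemma eqd_refl d F : eqd d F F. Proof. by []. Qed.

Lemma eq_eqd d F G : F = G -> eqd d F G. Proof. by move->. Qed.

Lemma eqd_sym d F G : eqd d F G -> eqd d G F.
Proof. by move=> h m md; rewrite h. Qed.

Lemma eqd_trans d F G H : eqd d F G -> eqd d G H -> eqd d F H.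
Proof. by move=> h k m md; rewrite h // k. Qed.

Lemma eqdW d d' F G : (d' <= d)%N -> eqd d F G -> eqd d' F G.
Proof. by move=> le h m md; apply: h; apply: leq_trans le. Qed.

Lemma ordW d d' F : (d' <= d)%N -> ord d F -> ord d' F.
Proof. by move=> le h m md; apply: h; apply: leq_trans le. Qed.

Lemma eqd_eq F G : (forall d, eqd d F G) -> F = G.
Proof. by move=> h; apply: fpsP => m; apply: (h (mdeg m).+1). Qed.

Lemma eqd_ord d F G : ord d F -> ord d G -> eqd d F G.
Proof. by move=> h k m md; rewrite h // k. Qed.

Lemma eqdB d F F' G G' : eqd d F F' -> eqd d G G' -> eqd d (F - G) (F' - G').
Proof. by move=> h k m md; rewrite !fpsD !fpsN h // k. Qed.

Lemma eqdD d F F' G G' : eqd d F F' -> eqd d G G' -> eqd d (F + G) (F' + G').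
Proof. by move=> h k m md; rewrite !fpsD h // k. Qed.

Lemma eqdZ d c F G : eqd d F G -> eqd d (c *: F) (c *: G).
Proof. by move=> h m md; rewrite !fpsZ h. Qed.

Lemma eqd_sub0 d F G : eqd d F G <-> ord d (F - G).
Proof.
split=> h m md; first by rewrite fpsD fpsN h // subrr.
by apply/eqP; rewrite -subr_eq0; apply/eqP; have := h m md.
Qed.

Lemma ordB d F G : ord d F -> ord d G -> ord d (F - G).
Proof. by move=> h k m md; rewrite fpsD fpsN h // k // subrr. Qed.

Lemma ordD d F G : ord d F -> ord d G -> ord d (F + G).
Proof. by move=> h k m md; rewrite fpsD h // k // addr0. Qed.

Lemma ordZ d c F : ord d F -> ord d (c *: F).
Proof. by move=> h m md; rewrite fpsZ h // mulr0. Qed.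

Lemma ord0_trivial F : ord 0 F. Proof. by []. Qed.

Lemma ord1E F : ord 1 F <-> F 0%MM = 0.
Proof.
split=> [h|h m]; first by apply: h; rewrite mdeg0.
by rewrite ltnS leqn0 mdeg_eq0 => /eqP ->.
Qed.

Lemma ordM a b F G : ord a F -> ord b G -> ord (a + b) (F * G).
Proof.
move=> hF hG m md /=; apply: big1 => -[k1 k2] /=.
move: (bmnm k1) (bmnm k2) => {}k1 {}k2 /eqP e.
have [lt|le] := ltnP (mdeg k1) a; first by rewrite hF // mul0r.
rewrite [G _]hG ?mulr0 // -(ltn_add2l a); apply: leq_ltn_trans md.
by rewrite e mdegD leq_add2r.
Qed.

Lemma ord_fX i : ord 1 (fX i : fps K n).
Proof. by apply/ord1E; rewrite /= eq_sym mnm1_eq0. Qed.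

Lemma eqdM d F F' G G' : eqd d F F' -> eqd d G G' -> eqd d (F * G) (F' * G').
Proof.
by move=> h k m md; apply: fpsM_eq => i im; [apply: h|apply: k];
  apply: leq_ltn_trans md.
Qed.

(** Closeness of two series of order at least [a], measured relatively to [a].
    Relative closeness is preserved by products, which is what makes composition
    with a series of order [a] gain [a - 1] degrees of precision. *)
Definition close a e F G := [/\ ord a F, ord a G & eqd (a + e) F G].

Lemma closeM a b e F F' G G' :
  close a e F F' -> close b e G G' -> close (a + b) e (F * G) (F' * G').
Proof.
move=> [aF aF' eF] [bG bG' eG]; split; try exact: ordM.
apply/eqd_sub0.
have -> : F * G - F' * G' = F * (G - G') + (F - F') * G' by ring.
apply: ordD.
  by rewrite -addnA; apply: ordM => //; apply/eqd_sub0.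
by rewrite addnAC; apply: ordM => //; apply/eqd_sub0.
Qed.

Lemma close1 e : close 0 e (1 : fps K n) 1.
Proof. by split. Qed.

Lemma closeX a e k F G : close a e F G -> close (k * a) e (F ^+ k) (G ^+ k).
Proof.
move=> h; elim: k => [|k IH]; first by rewrite mul0n !expr0; apply: close1.
by rewrite !exprS mulSn; apply: closeM.
Qed.

Lemma close_refl a F : ord a F -> forall e, close a e F F.
Proof. by move=> h e; split. Qed.

Lemma close_monomial q e (G G' : 'I_q -> fps K n) (k : 'X_{1..q}) :
  (forall i, close 1 e (G i) (G' i)) ->
  close (mdeg k) e (\prod_i G i ^+ k i) (\prod_i G' i ^+ k i).
Proof.
move=> h; rewrite mdegE.
elim/big_ind3: _ => [|a1 F1 F1' a2 F2 F2'|i _]; first exact: close1.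
- exact: closeM.
- by rewrite -[X in close X](muln1 (k i)); apply: closeX.
Qed.

Lemma ord_monomial q (G : 'I_q -> fps K n) (k : 'X_{1..q}) :
  (forall i, ord 1 (G i)) -> ord (mdeg k) (\prod_i G i ^+ k i).
Proof. by move=> h; case: (@close_monomial q 0 G G k) => // i; apply: close_refl. Qed.

End Order.

Section Contraction.
Variables (K : fieldType) (n : nat) (I : Type) (a : nat).
Implicit Types (X Y : I -> fps K n).

Definition contraction (T : (I -> fps K n) -> I -> fps K n) :=
  (forall X, (forall i, ord a (X i)) -> forall i, ord a (T X i)) /\
  (forall e X Y, (forall i, ord a (X i)) -> (forall i, ord a (Y i)) ->
     (forall i, eqd (a + e) (X i) (Y i)) ->
     forall i, eqd (a + e).+1 (T X i) (T Y i)).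

(** Banach's fixed point theorem for the degree metric: the coefficient of
    degree [d] of the iterates is stationary from rank [d + 1] on. *)
Lemma contraction_fixpoint T : contraction T ->
  exists X, (forall i, ord a (X i)) /\ T X = X.
Proof.
move=> [T0 Tc]; pose it k := iter k T (fun=> 0).
have ita k : forall i, ord a (it k i).
  by elim: k => [|k IH] i //=; apply: T0.
have itS k j i : eqd (a + k) (it k i) (it (k + j)%N i).
  (* All iterates agree below degree [a]; each further step gains one degree. *)
  elim: k i => [|k IH] i; first by rewrite addn0; apply: eqd_ord.
  by rewrite addSn addnS /=; apply: Tc.
pose X i := FPS (fun m => it (mdeg m).+1 i m).
have Xit d i : eqd d (X i) (it d i).
  move=> m md; have := itS (mdeg m).+1 (d - (mdeg m).+1)%N i m.
  by rewrite subnKC // => <- //; rewrite addnS ltnS leq_addl.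
have Xa i : ord a (X i) by move=> m; apply: ita.
exists X; split=> //; apply: funext => i; apply: eqd_eq => d.
apply: (@eqdW _ _ (a + d).+1); first by rewrite ltnW // ltnS leq_addl.
apply: (eqd_trans (G := it (a + d).+1 i)); last exact/eqd_sym/Xit.
by apply: Tc => // j; apply: Xit.
Qed.

Lemma contraction_unique T X Y : contraction T ->
  (forall i, ord a (X i)) -> (forall i, ord a (Y i)) ->
  T X = X -> T Y = Y -> X = Y.
Proof.
move=> [_ Tc] Xa Ya TX TY; apply: funext => i; apply: eqd_eq => d.
apply: (@eqdW _ _ (a + d)); first exact: leq_addl.
elim: d i => [|d IH] i; first by rewrite addn0; apply: eqd_ord.
by rewrite addnS -TX -TY; apply: Tc.
Qed.

End Contraction.

(** * Substitution *)

Section Substitution.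
Variables (K : fieldType) (n q : nat) (G : 'I_n -> fps K q).
Hypothesis G0 : forall i, ord 1 (G i).
Implicit Types (F H : fps K n).

Lemma feval_sum (p : {mpoly K[n]}) :
  mmap (GRing.in_alg (fps K q)) G p =
  \sum_(m <- msupp p) p@_m *: \prod_i G i ^+ m i.
Proof. by apply: eq_bigr => m _; rewrite /= mulr_algl. Qed.

Lemma feval_ftrunc d F :
  mmap (GRing.in_alg (fps K q)) G (ftrunc d F) =
  \sum_(k : 'X_{1..n < d}) F k *: \prod_i G i ^+ k i.
Proof.
rewrite /ftrunc raddf_sum /=; apply: eq_bigr => k _.
by rewrite mmapZ mmapX /= mulr_algl.
Qed.

(** The bridge to polynomial evaluation, through which the ring identities of
    substitution are inherited from those of [mmap]. *)
Lemma fcomp_feval d F (p : {mpoly K[n]}) :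
  (forall m, (mdeg m < d)%N -> p@_m = F m) ->
  eqd d (fcomp F G) (mmap (GRing.in_alg (fps K q)) G p).
Proof.
move=> pF m md.
have -> : fcomp F G m =
    mmap (GRing.in_alg (fps K q)) G (ftrunc (mdeg m).+1 F) m.
  by rewrite feval_ftrunc fps_sum.
apply/eqP; rewrite -subr_eq0 -fpsN -fpsD -raddfB /= feval_sum fps_sum.
apply/eqP; rewrite big_seq; apply: big1 => k kp; rewrite fpsZ.
have [le|lt] := leqP (mdeg k) (mdeg m); last first.
  by rewrite (@ord_monomial _ _ _ G k G0 m lt) mulr0.
rewrite mcoeffB mcoeff_ftrunc ?ltnS // pF ?subrr ?mul0r //.
exact: leq_ltn_trans md.
Qed.

Lemma fcomp_eqd d F H : eqd d F H -> eqd d (fcomp F G) (fcomp H G).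
Proof.
move=> FH.
apply: (eqd_trans (G := mmap (GRing.in_alg (fps K q)) G (ftrunc d F))).
  by apply: fcomp_feval => m md; rewrite mcoeff_ftrunc.
apply/eqd_sym; apply: fcomp_feval => m md.
by rewrite mcoeff_ftrunc // FH.
Qed.

Lemma fcompD F H : fcomp (F + H) G = fcomp F G + fcomp H G.
Proof.
by apply: fpsP => m /=; rewrite -big_split; apply: eq_bigr => k _; rewrite mulrDl.
Qed.

Lemma fcompZ c F : fcomp (c *: F) G = c *: fcomp F G.
Proof.
by apply: fpsP => m /=; rewrite mulr_sumr; apply: eq_bigr => k _; rewrite mulrA.
Qed.

Lemma fcompN F : fcomp (- F) G = - fcomp F G.
Proof. by rewrite -scaleN1r fcompZ scaleN1r. Qed.

Lemma fcompB F H : fcomp (F - H) G = fcomp F G - fcomp H G.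
Proof. by rewrite fcompD fcompN. Qed.

Lemma fcomp1 : fcomp 1 G = 1.
Proof.
apply: eqd_eq => d; rewrite -[X in eqd _ _ X](rmorph1 (mmap (GRing.in_alg _) G)).
by apply: fcomp_feval => m _; rewrite mcoeff1.
Qed.

Lemma fcompM F H : fcomp (F * H) G = fcomp F G * fcomp H G.
Proof.
apply: eqd_eq => d.
apply: (eqd_trans (G := mmap (GRing.in_alg _) G (ftrunc d F * ftrunc d H))).
  by apply: fcomp_feval => m md; rewrite -fmul_ftrunc.
rewrite rmorphM; apply: eqd_sym; apply: eqdM; apply: fcomp_feval => m md;
by rewrite mcoeff_ftrunc.
Qed.

Lemma fcomp_fX i : fcomp (fX i) G = G i.
Proof.
apply: eqd_eq => d.
apply: (eqd_trans (G := mmap (GRing.in_alg _) G 'X_i)).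
  by apply: fcomp_feval => m _; rewrite mcoeffX eq_sym.
by rewrite mmapX mmap1U.
Qed.

Lemma fcomp0 : fcomp 0 G = 0.
Proof. by rewrite -(scale0r 1) fcompZ !scale0r. Qed.

Lemma fcomp_at0 F : fcomp F G 0%MM = F 0%MM.
Proof.
have h : eqd 1 F (F 0%MM *: 1).
  move=> m; rewrite ltnS leqn0 mdeg_eq0 => /eqP ->.
  by rewrite fpsZ fps1 eqxx mulr1.
by rewrite (fcomp_eqd h) ?mdeg0 // fcompZ fcomp1 fpsZ fps1 eqxx mulr1.
Qed.

Lemma fcompX F k : fcomp (F ^+ k) G = fcomp F G ^+ k.
Proof. by elim: k => [|k IH]; rewrite ?fcomp1 // !exprS fcompM IH. Qed.

Lemma fcomp_sum I (r : seq I) (P : pred I) (E : I -> fps K n) :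
  fcomp (\sum_(i <- r | P i) E i) G = \sum_(i <- r | P i) fcomp (E i) G.
Proof. by elim/big_rec2: _ => [|i x y _ <-]; rewrite ?fcomp0 ?fcompD. Qed.

Lemma fcomp_prod I (r : seq I) (P : pred I) (E : I -> fps K n) :
  fcomp (\prod_(i <- r | P i) E i) G = \prod_(i <- r | P i) fcomp (E i) G.
Proof. by elim/big_rec2: _ => [|i x y _ <-]; rewrite ?fcomp1 ?fcompM. Qed.

Lemma funitE (F : fps K n) : (F \is a GRing.unit) = (F 0%MM != 0).
Proof. by []. Qed.

Lemma fcompV F : F \is a GRing.unit -> fcomp F^-1 G = (fcomp F G)^-1.
Proof.
move=> uF; have uF' : fcomp F G \is a GRing.unit.
  by rewrite [_ \is a _]unfold_in /= /funit fcomp_at0.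
apply: (mulIr uF'); rewrite -fcompM mulVr // mulVr //.
exact: fcomp1.
Qed.

Lemma ord_fcomp d F : ord d F -> ord d (fcomp F G).
Proof.
move=> h m md; have e : eqd d F 0 by [].
by rewrite (fcomp_eqd e) // fcomp0.
Qed.

End Substitution.

Lemma fcomp_eqr (K : fieldType) n q (F : fps K n) (G G' : 'I_n -> fps K q) :
  G =1 G' -> fcomp F G = fcomp F G'.
Proof. by move=> /funext ->. Qed.

(** Truncating [F] reduces associativity to the fact that substitution is a
    ring morphism. *)
Lemma fcompA (K : fieldType) n q r (F : fps K n) (G : 'I_n -> fps K q)
    (H : 'I_q -> fps K r) :
  (forall i, ord 1 (G i)) -> (forall i, ord 1 (H i)) ->
  fcomp (fcomp F G) H = fcomp F (fun i => fcomp (G i) H).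
Proof.
move=> G0 H0; apply: eqd_eq => d.
have GH0 i : ord 1 (fcomp (G i) H) by apply: ord_fcomp.
apply: (eqd_trans (G := fcomp (mmap (GRing.in_alg _) G (ftrunc d F)) H)).
  apply: fcomp_eqd => //; apply: fcomp_feval => // m md.
  by rewrite mcoeff_ftrunc.
apply/eqd_sym.
apply: (eqd_trans (G := mmap (GRing.in_alg _) (fun i => fcomp (G i) H) (ftrunc d F))).
  by apply: fcomp_feval => // m md; rewrite mcoeff_ftrunc.
rewrite !feval_ftrunc fcomp_sum //; apply: eq_eqd; apply: eq_bigr => k _.
rewrite fcompZ fcomp_prod //; congr (_ *: _).
by apply: eq_bigr => i _; rewrite fcompX.
Qed.

(** Composing on the left with a series of order [a] turns relative precision
    [e] into absolute precision [a + e]. *)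
Lemma fcomp_close (K : fieldType) n q a e (F : fps K n)
    (G G' : 'I_n -> fps K q) :
  ord a F -> (forall i, close 1 e (G i) (G' i)) ->
  eqd (a + e) (fcomp F G) (fcomp F G').
Proof.
move=> Fa GG m md /=; apply: eq_bigr => k _.
have [lt|le] := ltnP (mdeg (bmnm k)) a; first by rewrite Fa // !mul0r.
have [_ _ h] := close_monomial (bmnm k) GG.
by rewrite h //; apply: leq_trans md _; rewrite leq_add2r.
Qed.

Section Monomials.
Variables (K : fieldType) (n : nat).
Implicit Types (F : fps K n) (m k : 'X_{1..n}).

Definition fmon m : fps K n := FPS (fun k => (k == m)%:R).

Lemma mul_fmonE F k m :
  (F * fmon k) m = if (k <= m)%MM then F (m - k)%MM else 0.
Proof.
case: ifP => [le|nle]; last first.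
  rewrite /=; apply: big1 => -[k1 k2] /=.
  move: (bmnm k1) (bmnm k2) => {}k1 {}k2 /eqP e.
  case: eqP => [k2k|_]; last by rewrite mulr0.
  by move: nle; rewrite e k2k lem_addl.
rewrite [LHS](@fmul_coef_eq _ _ F (fmon k) (ftrunc (mdeg m).+1 F) 'X_[k]
  (mdeg m).+1) //.
- rewrite -[in X in _@_X](submK le) addmC mcoeffMX mcoeff_ftrunc //.
  by rewrite ltnS mdegB.
- by move=> i id; rewrite mcoeff_ftrunc.
- by move=> i id; rewrite mcoeffX eq_sym.
Qed.

Lemma fmonD m k : fmon (m + k)%MM = fmon m * fmon k.
Proof.
apply: fpsP => i; rewrite mul_fmonE /=; case: ifP => h.
  congr ((_ : bool)%:R); apply/eqP/eqP => [->|<-]; first by rewrite addmK.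
  by rewrite submK.
case: eqP => // e; move: h; rewrite e => /negP; case.
by apply/mnm_lepP => j; rewrite mnmDE leq_addl.
Qed.

Lemma fmon1 i : fmon U_(i)%MM = fX i. Proof. by []. Qed.

Lemma fmonMn m (j : nat) : fmon (m *+ j)%MM = fmon m ^+ j.
Proof. by elim: j => [|j IH]; rewrite ?mulm0n // mulmS fmonD IH exprS. Qed.

Lemma fmon_sum I (r : seq I) (P : pred I) (E : I -> 'X_{1..n}) :
  fmon (\sum_(i <- r | P i) E i)%MM = \prod_(i <- r | P i) fmon (E i).
Proof. by elim/big_rec2: _ => [|i x y _ <-]; rewrite ?fmonD. Qed.

Lemma fX_monomial m : \prod_i fX i ^+ m i = fmon m.
Proof.
rewrite [in RHS](multinomUE_id m) fmon_sum.
by apply: eq_bigr => i _; rewrite fmonMn fmon1.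
Qed.

Lemma fcomp_id F : fcomp F fX = F.
Proof.
apply: fpsP => m /=.
have lt : (mdeg m < (mdeg m).+1)%N by [].
rewrite (bigD1 (BMultinom lt)) //= fX_monomial /= eqxx mulr1 big1 ?addr0 //.
move=> k; rewrite -val_eqE /= => km.
by rewrite fX_monomial /= eq_sym (negPf km) mulr0.
Qed.

Lemma mulfX_coef F i m : (F * fX i) (m + U_(i))%MM = F m.
Proof.
rewrite -fmon1 mul_fmonE addmK ifT //.
by apply/mnm_lepP => j; rewrite mnmDE leq_addl.
Qed.

Lemma mulfX_coef0 F i m : m i = 0%N -> (F * fX i) m = 0.
Proof.
move=> mi; rewrite -fmon1 mul_fmonE ifF //; apply/negbTE/negP.
by move=> /mnm_lepP /(_ i); rewrite mnm1E eqxx mi.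
Qed.

Lemma mulfX_inj i : injective (fun F => F * fX i).
Proof.
by move=> F H /= e; apply: fpsP => m; rewrite -(mulfX_coef F i) e mulfX_coef.
Qed.

End Monomials.

(** * The monoid of formal (anti-)holomorphic maps *)

Section Conjugation.
Variables (C : numClosedFieldType) (n : nat).
Implicit Types (F G : fps C n).

Lemma fconjK F : fconj (fconj F) = F.
Proof. by apply: fpsP => m /=; rewrite conjCK. Qed.

Lemma fconjD F G : fconj (F + G) = fconj F + fconj G.
Proof. by apply: fpsP => m /=; rewrite rmorphD. Qed.

Lemma fconjN F : fconj (- F) = - fconj F.
Proof. by apply: fpsP => m /=; rewrite rmorphN. Qed.

Lemma fconjB F G : fconj (F - G) = fconj F - fconj G.
Proof. by rewrite fconjD fconjN. Qed.

Lemma fconjZ c F : fconj (c *: F) = c^* *: fconj F.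
Proof. by apply: fpsP => m /=; rewrite rmorphM. Qed.

Lemma fconjM F G : fconj (F * G) = fconj F * fconj G.
Proof.
apply: fpsP => m /=; rewrite rmorph_sum; apply: eq_bigr => k _.
by rewrite rmorphM.
Qed.

Lemma fconj1 : fconj 1 = 1 :> fps C n.
Proof. by apply: fpsP => m /=; rewrite rmorph_nat. Qed.

Lemma fconjX F k : fconj (F ^+ k) = fconj F ^+ k.
Proof. by elim: k => [|k IH]; rewrite ?expr0 ?fconj1 // !exprS fconjM IH. Qed.

Lemma fconj_prod I (r : seq I) (P : pred I) (E : I -> fps C n) :
  fconj (\prod_(i <- r | P i) E i) = \prod_(i <- r | P i) fconj (E i).
Proof. by elim/big_rec2: _ => [|i x y _ <-]; rewrite ?fconj1 ?fconjM. Qed.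

Lemma fconj_fX i : fconj (fX i) = fX i :> fps C n.
Proof. by apply: fpsP => m /=; rewrite rmorph_nat. Qed.

Lemma ord_fconj d F : ord d F -> ord d (fconj F).
Proof. by move=> h m md /=; rewrite h // rmorph0. Qed.

(** A map composed on the left with an anti-holomorphic one has the
    coefficients of its components conjugated. *)
Definition cj (b : bool) F := if b then fconj F else F.

Lemma ord_cj b d F : ord d F -> ord d (cj b F).
Proof. by case: b => //; apply: ord_fconj. Qed.

Lemma cj_cj a b F : cj a (cj b F) = cj (a (+) b) F.
Proof. by case: a b => [] [] //=; rewrite fconjK. Qed.

Lemma cjM b F G : cj b (F * G) = cj b F * cj b G.
Proof. by case: b => //=; rewrite fconjM. Qed.

Lemma cj_fX b i : cj b (fX i) = fX i.
Proof. by case: b => //=; rewrite fconj_fX. Qed.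

End Conjugation.

Lemma fconj_fcomp (C : numClosedFieldType) n q (F : fps C n)
    (G : 'I_n -> fps C q) :
  fconj (fcomp F G) = fcomp (fconj F) (fun i => fconj (G i)).
Proof.
apply: fpsP => m /=; rewrite rmorph_sum; apply: eq_bigr => k _.
rewrite rmorphM; congr (_ * _).
have := congr1 (fun S : fps C q => S m)
  (fconj_prod (index_enum _) xpredT (fun i => G i ^+ (bmnm k) i)).
move=> /= ->; congr (fcoef _ _); apply: eq_bigr => i _.
by rewrite fconjX.
Qed.

Lemma cj_fcomp (C : numClosedFieldType) b n q (F : fps C n)
    (G : 'I_n -> fps C q) :
  cj b (fcomp F G) = fcomp (cj b F) (fun i => cj b (G i)).
Proof. by case: b => //=; apply: fconj_fcomp. Qed.

Section Maps.
Variables (C : numClosedFieldType) (n : nat).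
Implicit Types (f g h : fmap C n) (d : 'I_n -> C).

Lemma fmapP f g : antihol f = antihol g -> (forall i, comps f i = comps g i) ->
  f = g.
Proof. by case: f g => [a F] [b G] /= -> /funext ->. Qed.

Lemma ord1_fixes0 f : fixes0 f -> forall i, ord 1 (comps f i).
Proof. by move=> f0 i; apply/ord1E. Qed.

Lemma comps_mcomp f g i :
  comps (mcomp f g) i = fcomp (comps f i) (fun j => cj (antihol f) (comps g j)).
Proof. by []. Qed.

Lemma fixes0_mcomp f g : fixes0 f -> fixes0 g -> fixes0 (mcomp f g).
Proof.
move=> f0 g0 i; rewrite comps_mcomp fcomp_at0 // => j.
by apply: ord_cj; apply: ord1_fixes0.
Qed.

Lemma mcompA f g h : fixes0 g -> fixes0 h ->
  mcomp f (mcomp g h) = mcomp (mcomp f g) h.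
Proof.
move=> g0 h0; apply: fmapP => [|i]; first by rewrite /= addbA.
rewrite !comps_mcomp fcompA; first last.
- by move=> j; apply: ord_cj; apply: ord1_fixes0.
- by move=> j; apply: ord_cj; apply: ord1_fixes0.
apply: fcomp_eqr => j /=; rewrite cj_fcomp.
by apply: fcomp_eqr => k; rewrite cj_cj.
Qed.

Lemma mcomp_idl f : fixes0 f -> mcomp (idmap C n) f = f.
Proof.
move=> f0; apply: fmapP => // i; rewrite comps_mcomp /= fcomp_fX //.
exact: ord1_fixes0.
Qed.

Lemma mcomp_idr f : mcomp f (idmap C n) = f.
Proof.
apply: fmapP => [|i]; first by rewrite /= addbF.
rewrite comps_mcomp -[RHS]fcomp_id; apply: fcomp_eqr => j.
by rewrite cj_fX.
Qed.

(** Conjugacy in multiplicative form, where the inverse of [Psi] only has to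
    exist. *)
Lemma conjugates_intro Psi Psi' f g : inverse_maps Psi Psi' ->
  fixes0 f -> fixes0 g -> mcomp f Psi = mcomp Psi g -> conjugates Psi f g.
Proof.
move=> iP f0 g0 e; exists Psi'; split=> //; case: iP => _ [P0 P'0] _ P'P.
by rewrite e mcompA // P'P mcomp_idl.
Qed.

Lemma conjugates_elim Psi f g : fixes0 f -> conjugates Psi f g ->
  mcomp f Psi = mcomp Psi g.
Proof.
move=> f0 [P' [[_ [P0 P'0] PP' _] <-]].
have fP0 : fixes0 (mcomp f Psi) by apply: fixes0_mcomp.
by rewrite mcompA // PP' mcomp_idl.
Qed.

Lemma inverse_maps_sym f g : inverse_maps f g -> inverse_maps g f.
Proof. by case=> [[? ?] [? ?] ? ?]; split. Qed.

Lemma inverse_maps_comp f f' g g' : inverse_maps f f' -> inverse_maps g g' ->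
  inverse_maps (mcomp f g) (mcomp g' f').
Proof.
move=> [[af af'] [f0 f'0] ff' f'f] [[ag ag'] [g0 g'0] gg' g'g].
have gf0 : fixes0 (mcomp g' f') by apply: fixes0_mcomp.
have fg0 : fixes0 (mcomp f g) by apply: fixes0_mcomp.
split; rewrite ?af ?ag ?af' ?ag' /= ?af ?ag ?af' ?ag' //.
  by rewrite -mcompA // [mcomp g _]mcompA // gg' mcomp_idl // ff'.
by rewrite -mcompA // [mcomp f' _]mcompA // f'f mcomp_idl // g'g.
Qed.

Definition diag_part d f := forall i, ord 2 (comps f i - d i *: fX i).

Lemma diag_part_fixes0 d f : diag_part d f -> fixes0 f.
Proof.
move=> df i; have := df i 0%MM; rewrite mdeg0 => /(_ isT)/eqP.
by rewrite fpsD fpsN fpsZ (proj1 (ord1E _) (@ord_fX C n i)) mulr0 subr0 => /eqP.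
Qed.

Lemma diag_part_coef d f : diag_part d f -> forall i, comps f i U_(i)%MM = d i.
Proof.
move=> df i; have := df i U_(i)%MM; rewrite mdeg1 => /(_ isT)/eqP.
by rewrite fpsD fpsN fpsZ /= eqxx mulr1 subr_eq0 => /eqP.
Qed.

Lemma diag_part_linear d f : fixes0 f ->
  (forall i j, linear_part (comps f) i j = d i *+ (i == j)) -> diag_part d f.
Proof.
move=> f0 lin i m; rewrite ltnS leq_eqVlt ltnS leqn0 mdeg_eq0 orbC.
case/orP => [/eqP -> |/mdeg1P [j /eqP ->]].
  by rewrite fpsD fpsN fpsZ f0 (proj1 (ord1E _) (@ord_fX C n i)) mulr0 subr0.
have := lin i j; rewrite mxE fpsD fpsN fpsZ => -> /=.
by rewrite eq_mnm1 [j == i]eq_sym; case: eqP => _; rewrite ?mulr1 ?mulr0 subrr.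
Qed.

Lemma diag_part_comp d e f g : antihol f = false ->
  diag_part d f -> diag_part e g -> diag_part (fun i => d i * e i) (mcomp f g).
Proof.
move=> af df dg i; rewrite comps_mcomp af /=.
have g0 j : ord 1 (comps g j) by apply/ord1_fixes0/(diag_part_fixes0 dg).
have -> : fcomp (comps f i) (comps g) - (d i * e i) *: fX i =
  fcomp (comps f i - d i *: fX i) (comps g) + d i *: (comps g i - e i *: fX i).
  by rewrite fcompB // fcompZ fcomp_fX // scalerBr scalerA addrA subrK.
by apply: ordD; [apply: ord_fcomp|apply: ordZ].
Qed.

Lemma scale_fX d (F : 'I_n -> fps C n) i : (forall i, ord 1 (F i)) ->
  fcomp (d i *: fX i) F = d i *: F i.
Proof. by move=> F0; rewrite fcompZ fcomp_fX. Qed.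

(** Formal inverse function theorem: a right inverse [x] of [d x + g] is the
    fixed point of [X |-> d^-1 (x - g(X))]. *)
Lemma right_inverse d f : antihol f = false -> diag_part d f ->
  (forall i, d i != 0) ->
  exists f', [/\ antihol f' = false, diag_part (fun i => (d i)^-1) f' &
                 mcomp f f' = idmap C n].
Proof.
move=> af df d0; pose g i := comps f i - d i *: fX i.
pose T (X : 'I_n -> fps C n) i := (d i)^-1 *: (fX i - fcomp (g i) X).
have cT : contraction 1 T.
  split=> [X X0 i|e X Y X0 Y0 XY i].
    apply: ordZ; apply: ordB; first exact: ord_fX.
    by apply: ord_fcomp => //; apply: ordW (df i).
  apply: eqdZ; apply: eqdB; first exact: eqd_refl.
  by apply: (@fcomp_close _ _ _ 2 e) => [|j]; first exact: df.
have [X [X0 TX]] := contraction_fixpoint cT.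
exists (FMap false X); split=> //.
  move=> i /=; rewrite -TX /T scalerBr addrC addKr -scalerN.
  apply: ordZ => m md; rewrite fpsN (@ord_fcomp _ _ _ _ _ 2) ?oppr0 //.
  exact: df.
apply: fmapP => [|i]; first by rewrite /= af.
rewrite comps_mcomp af /=.
have -> : comps f i = g i + d i *: fX i by rewrite subrK.
rewrite fcompD fcompZ fcomp_fX //.
have -> : X i = T X i by rewrite TX.
by rewrite /T scalerA mulfV // scale1r addrC subrK.
Qed.

(** A right inverse has itself a right inverse, which must be [f]. *)
Lemma inverse_theorem d f : antihol f = false -> diag_part d f ->
  (forall i, d i != 0) ->
  exists f', inverse_maps f f' /\ diag_part (fun i => (d i)^-1) f'.
Proof.
move=> af df d0; have [g [ag dg fg]] := right_inverse af df d0.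
have [|h [ah dh gh]] := right_inverse ag dg; first by move=> i; rewrite invr_eq0.
have f0 := diag_part_fixes0 df; have g0 := diag_part_fixes0 dg.
have h0 := diag_part_fixes0 dh.
have fh : f = h by rewrite -(mcomp_idr f) -gh mcompA // fg mcomp_idl.
by exists g; split=> //; split=> //; rewrite fh.
Qed.

End Maps.

(** * Poincare-Dulac normalization and rigidity *)

Section Dulac.
Variables (C : numClosedFieldType) (n : nat).
Implicit Types (alpha beta mu : 'I_n -> C) (X F G : 'I_n -> fps C n).

Definition wt alpha (m : 'X_{1..n}) : C := \prod_i alpha i ^+ m i.

Definition diagm alpha : 'I_n -> fps C n := fun i => alpha i *: fX i.

Definition equivariant alpha beta X :=
  forall i m, wt alpha m * X i m = beta i * X i m.

Lemma ord_diagm alpha i : ord 1 (diagm alpha i).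
Proof. by apply: ordZ; apply: ord_fX. Qed.

Lemma fcomp_diagm alpha (F : fps C n) m :
  fcomp F (diagm alpha) m = wt alpha m * F m.
Proof.
have lt : (mdeg m < (mdeg m).+1)%N by [].
have prodE (k : 'X_{1..n}) :
    \prod_i diagm alpha i ^+ k i = wt alpha k *: fmon C k.
  rewrite -fX_monomial /wt -scaler_prod; apply: eq_bigr => i _.
  by rewrite exprZn.
rewrite /= (bigD1 (BMultinom lt)) //= prodE /= eqxx mulr1 mulrC.
rewrite big1 ?addr0 // => k; rewrite -val_eqE /= => km.
by rewrite prodE /= eq_sym (negPf km) !mulr0.
Qed.

Lemma equivariantP alpha beta X :
  equivariant alpha beta X <->
  (forall i, fcomp (X i) (diagm alpha) = beta i *: X i).
Proof.
split=> [h i|h i m]; last by rewrite -fcomp_diagm h.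
by apply: fpsP => m; rewrite fcomp_diagm h.
Qed.

(** If [X] intertwines two maps in normal form with linear parts [A] and [B],
    so does [Y = B^-1 X A]. The lowest degree terms of [X - Y] intertwine [A]
    and [B], so they only involve monomials with [alpha^m = beta_i]; but on
    such monomials [X] and [Y] have the same coefficient. Hence [X = Y]. *)
Theorem rigidity alpha beta X F G :
  (forall i, beta i != 0) -> (forall i, ord 1 (X i)) ->
  diag_part alpha (FMap false F) -> diag_part beta (FMap false G) ->
  equivariant alpha alpha F -> equivariant beta beta G ->
  (forall i, fcomp (X i) F = fcomp (G i) X) -> equivariant alpha beta X.
Proof.
move=> b0 X0 dF dG /equivariantP eF /equivariantP eG XF.
have F0 i : ord 1 (F i) := ord1_fixes0 (diag_part_fixes0 dF) i.
have A0 := ord_diagm alpha; have B0 := ord_diagm beta.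
pose Y i := (beta i)^-1 *: fcomp (X i) (diagm alpha).
have Y0 i : ord 1 (Y i) by apply: ordZ; apply: ord_fcomp.
have XA i : fcomp (X i) (diagm alpha) = beta i *: Y i.
  by rewrite scalerA mulfV // scale1r.
have YF i : fcomp (Y i) F = fcomp (G i) Y.
  rewrite fcompZ fcompA //.
  have -> : (fun j => fcomp (diagm alpha j) F) = (fun j => fcomp (F j) (diagm alpha)).
    by apply: funext => j; rewrite eF scale_fX.
  rewrite -fcompA // XF fcompA //.
  have -> : (fun j => fcomp (X j) (diagm alpha)) = (fun j => fcomp (diagm beta j) Y).
    by apply: funext => j; rewrite XA scale_fX.
  by rewrite -fcompA // eG fcompZ scalerA mulVf // scale1r.
have XY : X = Y.
  apply: funext => i; apply: eqd_eq => d.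
  elim: d i => [|d IH] i //; case: d => [|d] in IH *; first exact: eqd_ord.
  move=> m md; have [lt|le] := ltnP (mdeg m) d.+1; first exact: IH.
  have [res|nres] := eqVneq (wt alpha m) (beta i).
    by rewrite fpsZ fcomp_diagm res mulrA mulVf // mul1r.
  pose D := X i - Y i.
  have Dd : ord d.+1 D by apply/eqd_sub0.
  suff : eqd d.+2 (fcomp D (diagm alpha)) (beta i *: D).
    move=> /(_ m md); rewrite fcomp_diagm fpsZ => /eqP.
    rewrite -subr_eq0 -mulrBl mulf_eq0 subr_eq0 (negPf nres) /=.
    by rewrite subr_eq0 => /eqP.
  apply: (eqd_trans (G := fcomp D F)).
    rewrite -[d.+2]addn1; apply: fcomp_close => // j; split=> //.
    exact/eqd_sym/eqd_sub0/dF.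
  rewrite fcompB // XF YF scalerBr.
  have GE (Z : 'I_n -> fps C n) : (forall i, ord 1 (Z i)) ->
      fcomp (G i) Z = fcomp (G i - beta i *: fX i) Z + beta i *: Z i.
    by move=> Z0; rewrite fcompB // scale_fX // subrK.
  rewrite !GE //; apply/eqd_sub0.
  rewrite [X in ord _ X](_ : _ = fcomp (G i - beta i *: fX i) X -
    fcomp (G i - beta i *: fX i) Y); last by ring.
  by apply/eqd_sub0; apply: (@fcomp_close _ _ _ 2 d) => [|j]; [exact: dG|split].
apply/equivariantP => i; rewrite XA; congr (_ *: _).
by rewrite [in RHS]XY.
Qed.

(** The unknowns of the Poincare-Dulac theorem are the nonresonant part of the
    normalizing map [Psi] and the resonant part of the normal form [N]. They are
    packed into one family [x], coefficient by coefficient; the equation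
    [f o Psi = Psi o N] then says that [x] is the fixed point of a contraction. *)
Theorem poincare_dulac mu f : antihol f = false -> diag_part mu f ->
  exists Psi N : fmap C n,
    [/\ antihol Psi = false /\ antihol N = false,
        diag_part (fun=> 1) Psi, diag_part mu N,
        equivariant mu mu (comps N) & mcomp f Psi = mcomp Psi N].
Proof.
move=> af df.
pose s i := comps f i - mu i *: fX i.
(* On a nonresonant monomial, the term linear in [psi] of the equation is
   [(mu^m - mu_i) psi_m]. *)
pose psi (x : 'I_n -> fps C n) i := FPS (fun m =>
  if wt mu m == mu i then 0 else x i m / (wt mu m - mu i)).
pose nn (x : 'I_n -> fps C n) i := FPS (fun m =>
  if wt mu m == mu i then x i m else 0).
pose P x i := fX i + psi x i.
pose N x i := mu i *: fX i + nn x i.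
pose T x i := fcomp (s i) (P x) -
  (fcomp (psi x i) (N x) - fcomp (psi x i) (diagm mu)).
have psiE d x y : (forall i, eqd d (x i) (y i)) ->
    forall i, eqd d (psi x i) (psi y i).
  by move=> xy i m md /=; rewrite xy.
have nnE d x y : (forall i, eqd d (x i) (y i)) ->
    forall i, eqd d (nn x i) (nn y i).
  by move=> xy i m md /=; rewrite xy.
have psi2 x : (forall i, ord 2 (x i)) -> forall i, ord 2 (psi x i).
  by move=> x2 i m md /=; rewrite x2 // mul0r if_same.
have nn2 x : (forall i, ord 2 (x i)) -> forall i, ord 2 (nn x i).
  by move=> x2 i m md /=; rewrite x2 // if_same.
have P1 x : (forall i, ord 2 (x i)) -> forall i, ord 1 (P x i).
  move=> x2 i; apply: ordD; first exact: ord_fX.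
  by apply: (@ordW _ _ 2) => //; apply: psi2.
have N1 x : (forall i, ord 2 (x i)) -> forall i, ord 1 (N x i).
  move=> x2 i; apply: ordD; first exact: ord_diagm.
  by apply: (@ordW _ _ 2) => //; apply: nn2.
have cT : contraction 2 T.
  split=> [x x2 i|e x y x2 y2 xy i].
    apply: ordB; first by apply: ord_fcomp; [exact: P1|exact: df].
    apply: ordB; apply: ord_fcomp; try exact: psi2; first exact: N1.
    exact: ord_diagm.
  apply: eqdB.
    apply: (@fcomp_close _ _ _ 2 (1 + e)) => [|j]; first exact: df.
    split; [exact: P1|exact: P1|]; apply: eqdD; first exact: eqd_refl.
    exact: psiE.
  apply/eqd_sub0.
  set u := psi x i; set v := psi y i.
  (* The first difference is a series of order 2 composed with close maps; in
     the second one, [u - v] is small and [N] is tangent to its linear part. *)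
  have -> : fcomp u (N x) - fcomp u (diagm mu) -
      (fcomp v (N y) - fcomp v (diagm mu)) =
      (fcomp u (N x) - fcomp u (N y)) +
      (fcomp (u - v) (N y) - fcomp (u - v) (diagm mu)).
    by rewrite !fcompB; ring.
  apply: ordD; apply/eqd_sub0.
    apply: (@fcomp_close _ _ _ 2 (1 + e)) => [|j]; first exact: psi2.
    split; [exact: N1|exact: N1|]; apply: eqdD; first exact: eqd_refl.
    exact: nnE.
  have -> : (2 + e).+1 = (2 + e + 1)%N by rewrite addn1.
  apply: fcomp_close => [|j]; first by apply/eqd_sub0; apply: psiE.
  split; [exact: N1|exact: ord_diagm|].
  by apply/eqd_sub0; rewrite /N addrAC subrr add0r; apply: nn2.
have [x [x2 Tx]] := contraction_fixpoint cT.
exists (FMap false (P x)), (FMap false (N x)); split=> //.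
- by move=> i /=; rewrite scale1r addrAC subrr add0r; apply: psi2.
- by move=> i /=; rewrite addrAC subrr add0r; apply: nn2.
- move=> i m; rewrite fpsD fpsZ /=.
  have [->|ne] := eqVneq m U_(i)%MM.
    congr (_ * _); rewrite /wt (bigD1 i) //= mnm1E eqxx expr1 big1 ?mulr1 //.
    by move=> j ji; rewrite mnm1E eq_sym (negPf ji) expr0.
  by rewrite mulr0 add0r; case: eqP => [->//|_]; rewrite !mulr0.
apply: fmapP => [|i]; first by rewrite /= af.
rewrite !comps_mcomp af /=.
have Px1 := P1 x x2; have Nx1 := N1 x x2; have D1 := ord_diagm mu.
have -> : comps f i = s i + mu i *: fX i by rewrite subrK.
rewrite fcompD scale_fX // [P x i in RHS]/P fcompD fcomp_fX //.
have -> : fcomp (s i) (P x) =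
    x i + (fcomp (psi x i) (N x) - fcomp (psi x i) (diagm mu)).
  by rewrite -[in X in X + _]Tx /T subrK.
have xE : x i = nn x i + (fcomp (psi x i) (diagm mu) - mu i *: psi x i).
  apply: fpsP => m; rewrite !(fpsD, fpsN, fpsZ) fcomp_diagm /=.
  case: (eqVneq (wt mu m) (mu i)) => [_|ne]; first by rewrite !mulr0 subrr addr0.
  by rewrite -mulrBl add0r mulrC divfK // subr_eq0.
rewrite [in X in X + _]xE /P /N scalerDr; ring.
Qed.

End Dulac.

(** * Maps that are diagonal over the invariants xi eta *)

Section Toric.
Variables (C : numClosedFieldType) (p : nat).
Implicit Types (mu : 'I_p -> C) (A B : fps C p) (sw : 'I_p -> bool) (pi : 'I_p -> 'I_p)
  (c : bool -> 'I_p -> fps C p).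

Definition idx (b : bool) (j : 'I_p) : 'I_(p + p) :=
  if b then rshift p j else lshift p j.

Definition unidx (i : 'I_(p + p)) : bool * 'I_p :=
  match split i with inl j => (false, j) | inr j => (true, j) end.

Arguments idx : simpl never.

Lemma idxK b j : unidx (idx b j) = (b, j).
Proof.
by case: b; rewrite /unidx /idx -/(unsplit (inr j)) -?/(unsplit (inl j)) unsplitK.
Qed.

Lemma unidxK i : idx (unidx i).1 (unidx i).2 = i.
Proof. by rewrite /unidx; case: splitP => j ij; apply: val_inj. Qed.

Lemma idx_ind (P : 'I_(p + p) -> Prop) : (forall b j, P (idx b j)) -> forall i, P i.
Proof. by move=> h i; rewrite -(unidxK i). Qed.

Lemma idx_inj b b' j j' : idx b j = idx b' j' -> b = b' /\ j = j'.
Proof. by move=> e; have := idxK b j; rewrite e idxK => -[-> ->]. Qed.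

Lemma big_idx (R : Type) (x : R) (op : Monoid.com_law x) (F : 'I_(p + p) -> R) :
  \big[op/x]_i F i =
  op (\big[op/x]_j F (idx false j)) (\big[op/x]_j F (idx true j)).
Proof. exact: big_split_ord. Qed.

Lemma ord_xieta (j : 'I_p) : ord 1 (xi C j * eta C j).
Proof. by apply: (@ordW _ _ 2) => //; apply: (@ordM _ _ 1 1); apply: ord_fX. Qed.

Lemma at_xietaM A B : at_xieta (A * B) = at_xieta A * at_xieta B.
Proof. by apply: fcompM; apply: ord_xieta. Qed.

Lemma at_xieta1 : at_xieta 1 = 1 :> fps C (p + p).
Proof. by apply: fcomp1; apply: ord_xieta. Qed.

Lemma at_xieta_fX (j : 'I_p) : at_xieta (fX j) = xi C j * eta C j.
Proof. by apply: fcomp_fX; apply: ord_xieta. Qed.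

Lemma at_xieta_at0 A : at_xieta A 0%MM = A 0%MM.
Proof. by apply: fcomp_at0; apply: ord_xieta. Qed.

Lemma cj_at_xieta a A : cj a (at_xieta A) = at_xieta (cj a A).
Proof.
rewrite /at_xieta cj_fcomp; apply: fcomp_eqr => j.
by rewrite cjM !cj_fX.
Qed.

Lemma fcomp_at_xieta q A (G : 'I_(p + p) -> fps C q) :
  (forall i, ord 1 (G i)) ->
  fcomp (at_xieta A) G = fcomp A (fun j => G (idx false j) * G (idx true j)).
Proof.
move=> G0; rewrite fcompA //; last exact: ord_xieta.
by apply: fcomp_eqr => j; rewrite fcompM // !fcomp_fX.
Qed.

Definition dbl (P : 'X_{1..p}) : 'X_{1..p + p} :=
  [multinom P (unidx i).2 | i < p + p].
Definition half (m : 'X_{1..p + p}) : 'X_{1..p} :=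
  [multinom m (idx false j) | j < p].

Lemma dblE P b j : dbl P (idx b j) = P j.
Proof. by rewrite mnmE idxK. Qed.

Lemma dblK : cancel dbl half.
Proof. by move=> P; apply/mnmP => j; rewrite mnmE dblE. Qed.

Lemma xieta_monomial (k : 'X_{1..p}) :
  \prod_j (xi C j * eta C j) ^+ k j = fmon C (dbl k).
Proof.
rewrite -fX_monomial big_idx -big_split /=; apply: eq_bigr => j _.
by rewrite !dblE exprMn.
Qed.

Lemma at_xieta_coef A (m : 'X_{1..p + p}) :
  at_xieta A m = if m == dbl (half m) then A (half m) else 0.
Proof.
rewrite /=; case: eqP => [e|ne]; last first.
  apply: big1 => k _; rewrite xieta_monomial /=; case: eqP => [e|]; last by rewrite mulr0.
  by case: ne; rewrite e dblK.
have lt : (mdeg (half m) < (mdeg m).+1)%N.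
  rewrite ltnS [in leqRHS]e !mdegE [leqRHS]big_idx /= -[leqLHS]addn0.
  by apply: leq_add => //; apply: leq_sum => j _; rewrite dblE.
rewrite (bigD1 (BMultinom lt)) //= xieta_monomial /= -e eqxx mulr1.
rewrite big1 ?addr0 // => k; rewrite -val_eqE /= => km.
rewrite xieta_monomial /=; case: eqP => [e'|]; last by rewrite mulr0.
by case/eqP: km; have := congr1 half e'; rewrite dblK => ->.
Qed.

Lemma at_xieta_inj : injective (@at_xieta C p).
Proof.
move=> A B e; apply: fpsP => P; have : at_xieta A (dbl P) = at_xieta B (dbl P) by rewrite e.
by rewrite !at_xieta_coef dblK eqxx.
Qed.

(** The maps acting on the coordinates through functions of the invariants
    [zeta = xi eta]: the component of index [(b, j)] is a function of [zeta]
    times the coordinate of index [(b + sw j, pi j)]. The normal forms of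
    [sigma], [tau_i] and [rho] are all of this kind, and so are the changes of
    coordinates between them. *)
Definition toric (a : bool) sw pi c : fmap C (p + p) :=
  FMap a (fun i => at_xieta (c (unidx i).1 (unidx i).2) *
                   fX (idx ((unidx i).1 (+) sw (unidx i).2) (pi (unidx i).2))).

Lemma comps_toric a sw pi c b j :
  comps (toric a sw pi c) (idx b j) =
  at_xieta (c b j) * fX (idx (b (+) sw j) (pi j)).
Proof. by rewrite /= idxK. Qed.

Lemma fmap_idxP (f g : fmap C (p + p)) : antihol f = antihol g ->
  (forall b j, comps f (idx b j) = comps g (idx b j)) -> f = g.
Proof. by move=> e h; apply: fmapP => //; apply: idx_ind. Qed.

Lemma fixes0_toric a sw pi c : fixes0 (toric a sw pi c).
Proof.
apply: idx_ind => b j; rewrite comps_toric fpsM0.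
by rewrite (proj1 (ord1E _) (@ord_fX C _ _)) mulr0.
Qed.

(** The map induced on the invariants by a toric map; [a] records whether it
    is followed by an anti-holomorphic map. *)
Definition zmap a pi c : 'I_p -> fps C p :=
  fun k => cj a (c false k * c true k) * fX (pi k).

Lemma ord_zmap a pi c k : ord 1 (zmap a pi c k).
Proof. by rewrite -[1%N]add0n; apply: ordM; [exact: ord0_trivial|exact: ord_fX]. Qed.

Lemma at_xieta_toric A a a' sw pi c :
  fcomp (at_xieta A) (fun i => cj a (comps (toric a' sw pi c) i)) =
  at_xieta (fcomp A (zmap a pi c)).
Proof.
rewrite fcomp_at_xieta; last first.
  by move=> i; apply/ord_cj/ord1_fixes0/fixes0_toric.
rewrite /at_xieta fcompA; first last.
- exact: ord_xieta.
- exact: ord_zmap.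
apply: fcomp_eqr => j; rewrite -/(at_xieta _) !comps_toric.
rewrite !cjM !cj_fX !cj_at_xieta /zmap cjM !at_xietaM at_xieta_fX /=.
by case: (sw j) => /=; rewrite /xi /eta; ring.
Qed.

Lemma toric_comp a sw pi c a' sw' pi' c' :
  mcomp (toric a sw pi c) (toric a' sw' pi' c') =
  toric (a (+) a') (fun j => sw j (+) sw' (pi j)) (fun j => pi' (pi j))
    (fun b j => fcomp (c b j) (zmap a pi' c') * cj a (c' (b (+) sw j) (pi j))).
Proof.
have G0 i : ord 1 (cj a (comps (toric a' sw' pi' c') i)).
  by apply/ord_cj/ord1_fixes0/fixes0_toric.
apply: fmap_idxP => // b j; rewrite comps_mcomp !comps_toric [antihol _]/=.
rewrite fcompM // at_xieta_toric fcomp_fX // comps_toric.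
by rewrite cjM cj_fX cj_at_xieta at_xietaM mulrA addbA.
Qed.

Lemma toric_inj a sw pi c c' : toric a sw pi c = toric a sw pi c' ->
  forall b j, c b j = c' b j.
Proof.
move=> e b j; apply: at_xieta_inj; apply: (@mulfX_inj C _ (idx (b (+) sw j) (pi j))).
by rewrite -(comps_toric a sw pi c) -(comps_toric a sw pi c') e.
Qed.

Lemma eq_toric a sw pi sw' pi' c c' : sw =1 sw' -> pi =1 pi' ->
  (forall b j, c b j = c' b j) -> toric a sw pi c = toric a sw' pi' c'.
Proof.
move=> e1 e2 e3; apply: fmap_idxP => // b j.
by rewrite !comps_toric e1 e2 e3.
Qed.

Lemma sigma_nfE (M : 'I_p -> fps C p) :
  sigma_nf M = toric false (fun=> false) id (fun b j => if b then (M j)^-1 else M j).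
Proof.
apply: fmap_idxP => // b j; rewrite comps_toric /=.
have := idxK b j; rewrite /unidx.
by case: (split _) => k [<- <-].
Qed.

Lemma tau_nfE (L : 'I_p -> fps C p) :
  tau_nf L = toric false (fun=> true) id (fun b j => if b then (L j)^-1 else L j).
Proof.
apply: fmap_idxP => // b j; rewrite comps_toric /=.
have := idxK b j; rewrite /unidx.
by case: (split _) => k [<- <-].
Qed.

Lemma idmapE : idmap C (p + p) = toric false (fun=> false) id (fun _ _ => 1).
Proof.
apply: fmap_idxP => // b j; rewrite comps_toric /= at_xieta1 mul1r.
by rewrite addbF.
Qed.

Definition ext (mu : 'I_p -> C) (i : 'I_(p + p)) : C :=
  if (unidx i).1 then (mu (unidx i).2)^-1 else mu (unidx i).2.

Lemma extE mu b j : ext mu (idx b j) = if b then (mu j)^-1 else mu j.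
Proof. by rewrite /ext idxK. Qed.

(** The exponent [P] of [xi] and [Q] of [eta] satisfy
    [mu^(P - Q) = mu_j^(+-1)], which by nonresonance determines [P - Q]. *)
Lemma resonant_monomial mu (m : 'X_{1..p + p}) b j :
  (forall k, mu k != 0) -> nonresonant mu ->
  wt (ext mu) m = ext mu (idx b j) ->
  exists P, m = (dbl P + U_(idx b j))%MM.
Proof.
move=> mu0 nr e.
pose D k : int := if k == j then (if b then -1 else 1) else 0.
pose Q := \row_k ((m (idx false k))%:Z - (m (idx true k))%:Z - D k).
have Q0 : Q = 0.
  apply/eqP; apply/negP => /negP /nr /eqP; apply.
  transitivity (wt (ext mu) m * (ext mu (idx b j))^-1); last first.
    rewrite e mulfV // extE; case: (b) => //; by rewrite invr_eq0.
  rewrite /wt big_idx /= -big_split /=.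
  have -> : (ext mu (idx b j))^-1 = \prod_k mu k ^ (- D k).
    rewrite (bigD1 j) //= big1 ?mulr1; last first.
      by move=> k kj; rewrite /D (negPf kj) oppr0 expr0z.
    by rewrite extE /D eqxx; case: (b); rewrite ?opprK ?invrK.
  rewrite -big_split /=; apply: eq_bigr => k _.
  rewrite mxE !extE !expfzDr // -exprnN -exprnP exprVn.
  by rewrite exprnN.
have mE k : (m (idx false k) + (b && (k == j)) =
             m (idx true k) + (~~ b && (k == j)))%N.
  have := congr1 (fun R : 'rV_p => R 0 k) Q0; rewrite !mxE /D => /eqP.
  rewrite subr_eq0 subr_eq => /eqP h.
  have inj : injective Posz by move=> ? ? [].
  by apply: inj; rewrite !PoszD h; case: eqP => _; case: (b) => /=; ring.
exists (half (m - U_(idx b j))%MM).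
apply/mnmP; apply: idx_ind => b' k; rewrite mnmDE dblE mnmE mnmBE !mnm1E.
have eqi b1 b2 k1 k2 : (idx b1 k1 == idx b2 k2) = (b1 == b2) && (k1 == k2).
  by apply/eqP/andP => [/idx_inj [-> ->]|[/eqP -> /eqP ->]].
rewrite !eqi; have := mE k; rewrite [k == j]eq_sym.
by case: (b) (b') => -[] /=; case: (j == k) => /=;
  rewrite ?addn0 ?subn0 ?addn1 // => h; rewrite ?h ?subn1 //= -h.
Qed.

(** By nonresonance, the components only contain monomials [zeta^P] times one
    fixed coordinate. *)
Lemma toric_of_equivariant mu beta sw pi (f : fmap C (p + p)) :
  (forall k, mu k != 0) -> nonresonant mu ->
  (forall b j, beta (idx b j) = ext mu (idx (b (+) sw j) (pi j))) ->
  equivariant (ext mu) beta (comps f) ->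
  exists c, f = toric (antihol f) sw pi c.
Proof.
move=> mu0 nr bE eqv.
exists (fun b j => FPS (fun P =>
  comps f (idx b j) (dbl P + U_(idx (b (+) sw j) (pi j)))%MM)).
apply: fmap_idxP => // b j; rewrite comps_toric; apply: fpsP => m.
set F := comps f _; set i := idx (b (+) _) _.
have supp : F m != 0 -> exists P, m = (dbl P + U_(i))%MM.
  move=> Fm; apply: resonant_monomial => //; rewrite -bE.
  exact: (mulIf Fm) (eqv _ _).
have [mi|mi] := eqVneq (m i) 0%N.
  rewrite mulfX_coef0 //; apply/eqP; apply: contraT => /supp [P e].
  by move: mi; rewrite e mnmDE mnm1E eqxx addn1.
have em : m = (m - U_(i) + U_(i))%MM by rewrite submK // lep1mP.
rewrite [in RHS]em mulfX_coef at_xieta_coef.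
case: eqP => [e|ne] /=; first by rewrite -e -em.
apply/eqP; apply: contraT => /supp [P e]; case: ne.
by rewrite e addmK dblK.
Qed.

Lemma diag_part_linS mu (f : fmap C (p + p)) : fixes0 f ->
  linear_part (comps f) = linS mu -> diag_part (ext mu) f.
Proof.
move=> f0 lin; apply: diag_part_linear => // i j.
rewrite lin mxE; congr (_ *+ _); elim/idx_ind: i => b k.
by rewrite extE /idx; case: b; rewrite ?row_mxEl ?row_mxEr mxE.
Qed.

Lemma diag_part_toric d (c : bool -> 'I_p -> fps C p) :
  (forall b j, c b j 0%MM = d (idx b j)) ->
  diag_part d (toric false (fun=> false) id c).
Proof.
move=> cd; apply: idx_ind => b j; rewrite comps_toric addbF /=.
have -> : at_xieta (c b j) * fX (idx b j) - d (idx b j) *: fX (idx b j) =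
    (at_xieta (c b j) - d (idx b j) *: 1) * fX (idx b j).
  by rewrite mulrBl -scalerAl mul1r.
apply: (@ordM _ _ 1 1); last exact: ord_fX.
by apply/ord1E; rewrite fpsD fpsN fpsZ fps1 at_xieta_at0 cd eqxx mulr1 subrr.
Qed.

Lemma toric_at0 d (c : bool -> 'I_p -> fps C p) :
  diag_part d (toric false (fun=> false) id c) ->
  forall b j, c b j 0%MM = d (idx b j).
Proof.
move=> dc b j; rewrite -(diag_part_coef dc) comps_toric addbF.
by rewrite -[U_(idx b j)%MM]add0m mulfX_coef at_xieta_at0.
Qed.

End Toric.

(** * Logarithms and square roots of formal series *)

Section LogSqrt.
Variables (C : numClosedFieldType) (n : nat).
Implicit Types (F G U V L : fps C n).

(** The Euler vector field [sum_i z_i d/dz_i]; it determines a series up to its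
    constant term. *)
Definition euler F : fps C n := FPS (fun m => (mdeg m)%:R * F m).

Lemma eulerM F G : euler (F * G) = euler F * G + F * euler G.
Proof.
apply: fpsP => m /=; rewrite mulr_sumr -big_split; apply: eq_bigr => -[k1 k2] /=.
move: (bmnm k1) (bmnm k2) => {}k1 {}k2 /eqP ->.
by rewrite mdegD natrD; ring.
Qed.

Lemma euler1 : euler 1 = 0.
Proof. by apply: fpsP => m /=; case: eqP => [->|_]; rewrite ?mdeg0 ?mul0r ?mulr0. Qed.

Lemma eulerB F G : euler (F - G) = euler F - euler G.
Proof. by apply: fpsP => m /=; rewrite mulrBr. Qed.

Lemma eulerN F : euler (- F) = - euler F.
Proof. by apply: fpsP => m /=; rewrite mulrN. Qed.

Lemma eulerX F k : euler (F ^+ k) = k%:R *: (F ^+ k.-1 * euler F).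
Proof.
elim: k => [|k IH]; first by rewrite euler1 scale0r.
rewrite exprS eulerM IH /= -[k.+1]addn1 natrD scalerDl scale1r addrC mulrC.
congr (_ + _); last by rewrite mulrC.
case: k {IH} => [|k]; first by rewrite !scale0r mul0r.
by rewrite -scalerAl exprS /=; congr (_ *: _); ring.
Qed.

Lemma euler_eq0 F : euler F = 0 -> F = F 0%MM *: 1.
Proof.
move=> e; apply: fpsP => m; rewrite fpsZ fps1.
have := congr1 (fun G : fps C n => G m) e; rewrite /= => /eqP.
rewrite mulf_eq0 pnatr_eq0 mdeg_eq0; case: (eqVneq m 0%MM) => [-> _|_ /= /eqP ->].
  by rewrite mulr1.
by rewrite mulr0.
Qed.

Lemma flog_at0 U : flog U 0%MM = 0.
Proof. by rewrite /= mdeg0 big_geq. Qed.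

Lemma ord_sub1 U : U 0%MM = 1 -> ord 1 (U - 1).
Proof. by move=> U0; apply/ord1E; rewrite fpsD fpsN fps1 eqxx U0 subrr. Qed.

Lemma flog_trunc d U : U 0%MM = 1 ->
  eqd d (flog U) (\sum_(1 <= k < d) ((-1) ^+ k.+1 / k%:R) *: (U - 1) ^+ k).
Proof.
move=> U0 m md; rewrite fps_sum [RHS](big_cat_nat (n := (mdeg m).+1)) //=.
rewrite [X in _ = _ + X]big_nat_cond [X in _ = _ + X]big1 ?addr0 //.
move=> k /andP[/andP[mk _] _]; rewrite fpsX_small ?mulr0 //.
exact/ord1E/ord_sub1.
Qed.

Lemma euler_eqd d F G : eqd d F G -> eqd d (euler F) (euler G).
Proof. by move=> h m md /=; rewrite h. Qed.

Lemma eulerD F G : euler (F + G) = euler F + euler G.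
Proof. by apply: fpsP => m /=; rewrite mulrDr. Qed.

Lemma eulerZ c F : euler (c *: F) = c *: euler F.
Proof. by apply: fpsP => m /=; rewrite mulrCA. Qed.

Lemma euler_sum I (r : seq I) (P : pred I) (E : I -> fps C n) :
  euler (\sum_(i <- r | P i) E i) = \sum_(i <- r | P i) euler (E i).
Proof.
elim/big_rec2: _ => [|i x y _ <-]; last by rewrite eulerD.
by apply: fpsP => m; rewrite /= mulr0.
Qed.

Lemma ord_exp k F : ord 1 F -> ord k (F ^+ k).
Proof. by move=> /ord1E F0 m mk; apply: fpsX_small. Qed.

(** The termwise Euler derivative of the logarithmic series is a geometric
    series. *)
Lemma euler_flog U : U 0%MM = 1 -> U * euler (flog U) = euler U.
Proof.
move=> U0; pose N := U - 1; have N1 : ord 1 N := ord_sub1 U0.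
have eN : euler N = euler U by rewrite eulerB euler1 subr0.
have E1 : ord 1 (euler N) by apply/ord1E; rewrite /= mdeg0 mul0r.
apply: eqd_eq => -[|d] //.
have := eqdM (eqd_refl U) (euler_eqd (flog_trunc (d := d.+1) U0)).
move=> h; apply: (eqd_trans h) => {h}.
rewrite euler_sum big_add1 /= big_mkord.
under eq_bigr => k _.
  rewrite eulerZ eulerX scalerA divfK ?pnatr_eq0 //= 2!exprS !mulN1r opprK.
  rewrite scalerAl -exprZn scaleN1r.
  over.
rewrite -mulr_suml mulrA -/N.
have -> : U * \sum_(i < d) (- N) ^+ i = 1 - (- N) ^+ d.
  by rewrite -[RHS]opprB subrX1 -mulNr; congr (_ * _); rewrite /N; ring.
rewrite mulrBl mul1r eN; apply/eqd_sub0.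
rewrite addrAC subrr add0r -eN => m md.
rewrite fpsN; apply/eqP; rewrite oppr_eq0; apply/eqP.
rewrite (@ordM _ _ d 1) ?addn1 //; apply: ord_exp.
by apply/ord1E; rewrite fpsN (proj1 (ord1E N)) ?oppr0.
Qed.

(** The logarithm is characterized by its Euler derivative and constant term,
    so its identities reduce to those of the logarithmic derivative. *)
Lemma flog_eq U L : U 0%MM = 1 -> L 0%MM = 0 -> U * euler L = euler U ->
  flog U = L.
Proof.
move=> U0 L0 e; have uU : U \is a GRing.unit by rewrite funitE U0 oner_eq0.
apply/eqP; rewrite -subr_eq0; apply/eqP; rewrite (@euler_eq0 (flog U - L)).
  by rewrite fpsD fpsN flog_at0 L0 subrr scale0r.
rewrite eulerB; apply: (mulrI uU).
by rewrite mulr0 mulrBr e euler_flog // subrr.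
Qed.

Lemma funit1 U : U 0%MM = 1 -> U \is a GRing.unit.
Proof. by move=> U0; rewrite funitE U0 oner_eq0. Qed.

Lemma fpsV0 U : U \is a GRing.unit -> U^-1 0%MM = (U 0%MM)^-1.
Proof.
move=> uU; have : (U^-1 * U) 0%MM = 1 by rewrite mulVr // fps1 eqxx.
rewrite fpsM0 => e; apply: (mulIf (x := U 0%MM)); first by rewrite -funitE.
by rewrite e mulVf // -funitE.
Qed.

Lemma flogV U : U 0%MM = 1 -> flog U^-1 = - flog U.
Proof.
move=> U0; have uU := funit1 U0.
apply: flog_eq; first by rewrite fpsV0 // U0 invr1.
  by rewrite fpsN flog_at0 oppr0.
have := euler1; rewrite -(mulVr uU) eulerM => /eqP.
rewrite addr_eq0 => /eqP h; apply: (mulIr uU); rewrite h eulerN.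
by rewrite -(euler_flog U0); ring.
Qed.

Lemma flog_conj U : fconj (flog U) = flog (fconj U).
Proof.
apply: fpsP => m /=; rewrite rmorph_sum; apply: eq_bigr => k _.
rewrite !rmorphM fmorphV rmorph_nat rmorphXn rmorphN1; congr (_ * _).
have -> : fconj U - 1 = fconj (U - 1) by rewrite fconjB fconj1.
by rewrite -fconjX.
Qed.

(** With [S = r + x], the equation [S^2 = F] reads
    [x = (F - F(0) - x^2) / 2r], a contraction in [x]. *)
Lemma sqrt_exists F r : r ^+ 2 = F 0%MM -> F 0%MM != 0 ->
  exists2 S, S ^+ 2 = F & S 0%MM = r.
Proof.
move=> r2 F0; have r0 : r != 0 by apply: contraNneq F0 => r0; rewrite -r2 r0 expr0n.
have r20 : r *+ 2 != 0 by rewrite mulrn_eq0.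
pose T (x : unit -> fps C n) (_ : unit) :=
  (r *+ 2)^-1 *: ((F - F 0%MM *: 1) - x tt * x tt).
have F1 : ord 1 (F - F 0%MM *: 1).
  by apply/ord1E; rewrite fpsD fpsN fpsZ fps1 eqxx mulr1 subrr.
have cT : contraction 1 T.
  split=> [x x1 i|e x y x1 y1 xy i].
    by apply: ordZ; apply: ordB => //; apply: (@ordM _ _ 1 0).
  apply: eqdZ; apply: eqdB; first exact: eqd_refl.
  have cl : close 1 e (x tt) (y tt) by split.
  by have [_ _] := closeM cl cl.
have [x [x1 Tx]] := contraction_fixpoint cT.
exists (r *: 1 + x tt); last first.
  by rewrite fpsD fpsZ fps1 eqxx mulr1 (proj1 (ord1E _) (x1 tt)) addr0.
have h : (r *+ 2) *: x tt = F - F 0%MM *: 1 - x tt * x tt.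
  by rewrite -{1}Tx scalerA mulfV // scale1r.
have -> : F = (r *+ 2) *: x tt + x tt * x tt + F 0%MM *: 1.
  by rewrite h !subrK.
have -> : (r *+ 2) *: x tt = (r *: 1) * x tt *+ 2.
  by rewrite -scalerAl mul1r scalerMnl.
have -> : F 0%MM *: 1 = (r *: 1) * (r *: 1) :> fps C n.
  by rewrite -scalerAl mul1r scalerA -expr2 r2.
by ring.
Qed.

Lemma sqrt_unique U V : U ^+ 2 = V ^+ 2 -> U 0%MM = V 0%MM -> U 0%MM != 0 ->
  U = V.
Proof.
move=> e e0 U0; apply/eqP; rewrite -subr_eq0; apply/eqP.
have u : U + V \is a GRing.unit.
  by rewrite funitE fpsD -e0 -mulr2n mulrn_eq0.
apply: (mulIr u); rewrite mul0r.
by rewrite -subr_sqr e subrr.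
Qed.

End LogSqrt.

Lemma flog_fcomp (C : numClosedFieldType) n q (U : fps C n)
    (G : 'I_n -> fps C q) :
  (forall i, ord 1 (G i)) -> U 0%MM = 1 ->
  fcomp (flog U) G = flog (fcomp U G).
Proof.
move=> G0 U0; apply: eqd_eq => d.
apply: eqd_trans (fcomp_eqd G0 (flog_trunc U0)) _; apply/eqd_sym.
apply: eqd_trans (flog_trunc _) _; first by rewrite fcomp_at0.
apply: eq_eqd; rewrite fcomp_sum; apply: eq_bigr => k _.
by rewrite fcompZ fcompX // fcompB fcomp1.
Qed.

(** * Equivariance and conjugation *)

Section Equivariance.
Variables (C : numClosedFieldType) (n : nat).
Implicit Types (f g : fmap C n) (alpha beta gamma : 'I_n -> C).

Definition dmap alpha : fmap C n := FMap false (diagm alpha).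

Lemma equivariant_mcomp alpha beta f : antihol f = false -> fixes0 f ->
  equivariant alpha beta (comps f) <-> mcomp f (dmap alpha) = mcomp (dmap beta) f.
Proof.
move=> af f0; have f1 := ord1_fixes0 f0.
rewrite equivariantP; split=> [h|h i].
  apply: fmapP => [|i]; first by rewrite /= af.
  by rewrite !comps_mcomp af /= h scale_fX.
have := congr1 (fun g : fmap C n => comps g i) h.
by rewrite !comps_mcomp af /= scale_fX.
Qed.

Lemma fixes0_dmap alpha : fixes0 (dmap alpha).
Proof. by move=> i; apply/ord1E; apply: ord_diagm. Qed.

Lemma equivariant_comp alpha f g :
  antihol f = false -> antihol g = false -> fixes0 f -> fixes0 g ->
  equivariant alpha alpha (comps f) -> equivariant alpha alpha (comps g) ->
  equivariant alpha alpha (comps (mcomp f g)).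
Proof.
have D0 := fixes0_dmap alpha.
move=> af ag f0 g0 /equivariant_mcomp ef /equivariant_mcomp eg.
apply/equivariant_mcomp; rewrite /= ?af ?ag //; first exact: fixes0_mcomp.
by rewrite -mcompA // eg // mcompA // ef // -mcompA.
Qed.

Lemma equivariant_inverse alpha f f' : inverse_maps f f' ->
  equivariant alpha alpha (comps f) -> equivariant alpha alpha (comps f').
Proof.
have D0 := fixes0_dmap alpha.
move=> [[af af'] [f0 f'0] ff' f'f] /equivariant_mcomp ef.
apply/equivariant_mcomp => //.
have Df0 : fixes0 (mcomp (dmap alpha) f') by apply: fixes0_mcomp.
rewrite -[RHS]mcomp_idl // -f'f -mcompA //; congr (mcomp _ _).
by rewrite mcompA // ef // -mcompA // ff' mcomp_idr.
Qed.

Lemma wt_inv alpha m : wt (fun i => (alpha i)^-1) m = (wt alpha m)^-1.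
Proof.
rewrite /wt -prodfV; apply: eq_bigr => i _; exact: exprVn.
Qed.

Lemma wt_conj alpha m : wt (fun i => (alpha i)^*) m = (wt alpha m)^*.
Proof. by rewrite /wt rmorph_prod; apply: eq_bigr => i _; rewrite rmorphXn. Qed.

Lemma equivariant_inv alpha X :
  equivariant alpha alpha X ->
  equivariant (fun i => (alpha i)^-1) (fun i => (alpha i)^-1) X.
Proof.
move=> e i m; have [->|X0] := eqVneq (X i m) 0; first by rewrite !mulr0.
by rewrite wt_inv (mulIf X0 (e i m)).
Qed.

Lemma equivariant_conj alpha beta (X : 'I_n -> fps C n) :
  equivariant alpha beta X ->
  equivariant (fun i => (alpha i)^*) (fun i => (beta i)^*)
    (fun i => fconj (X i)).
Proof. by move=> e i m; rewrite wt_conj /= -!rmorphM e. Qed.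

Lemma diag_part_conj alpha f : diag_part alpha f ->
  diag_part (fun i => (alpha i)^*) (FMap false (fun i => fconj (comps f i))).
Proof.
move=> d i /=; have -> : fconj (comps f i) - (alpha i)^* *: fX i =
  fconj (comps f i - alpha i *: fX i) by rewrite fconjB fconjZ fconj_fX.
exact: ord_fconj.
Qed.

Lemma involution_cancel f g : fixes0 f -> fixes0 g -> involution f ->
  mcomp f (mcomp f g) = g.
Proof. by move=> f0 g0 i; rewrite mcompA // i mcomp_idl. Qed.

Lemma inverse_maps_unique (Psi P P' : fmap C n) : inverse_maps Psi P -> inverse_maps Psi P' ->
  P = P'.
Proof.
move=> [_ [P0 Q0] _ QP] [_ [_ Q'0] PQ' _].
by rewrite -[P]mcomp_idr -PQ' (mcompA _ P0 Q'0) QP mcomp_idl.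
Qed.

Lemma cnj_eq (Psi Psi' f g : fmap C n) : inverse_maps Psi Psi' -> conjugates Psi f g ->
  mcomp Psi' (mcomp f Psi) = g.
Proof. by move=> iP [P' [iP' <-]]; rewrite (inverse_maps_unique iP iP'). Qed.

Section Conjugate.
Variables (Psi Psi' : fmap C n).
Hypothesis Psi_inv : inverse_maps Psi Psi'.

Definition cnj f := mcomp Psi' (mcomp f Psi).

Lemma cnj_fixes0 f : fixes0 f -> fixes0 (cnj f).
Proof. by case: Psi_inv => _ [P0 P'0] _ _ f0; do !apply: fixes0_mcomp. Qed.

Lemma cnj_antihol f : antihol (cnj f) = antihol f.
Proof. by case: Psi_inv => -[a a'] _ _ _; rewrite /= a a' addbF. Qed.

Lemma cnjM f g : fixes0 f -> fixes0 g -> cnj (mcomp f g) = mcomp (cnj f) (cnj g).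
Proof.
move=> f0 g0; case: Psi_inv => _ [P0 P'0] PP' _.
have gP0 : fixes0 (mcomp g Psi) by apply: fixes0_mcomp.
rewrite /cnj -!mcompA //; try by do !apply: fixes0_mcomp.
by rewrite [mcomp Psi (mcomp _ _)]mcompA // PP' mcomp_idl.
Qed.

Lemma cnj_involution f : fixes0 f -> involution f -> involution (cnj f).
Proof.
move=> f0 e; rewrite /involution -cnjM // e /cnj.
by case: Psi_inv => _ [P0 _] _ P'P; rewrite mcomp_idl.
Qed.


End Conjugate.

End Equivariance.

(** * Existence of the normal form *)

Section Reversible.
Variables (C : numClosedFieldType) (p : nat).
Implicit Types (mu : 'I_p -> C) (l c : bool -> 'I_p -> fps C p).

(** [xi' = l eta, eta' = l' xi] acts on the invariants by
    [zeta |-> l l' zeta]. This is an involution tangent to the identity, hence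
    the identity: it is linearized by its average with the identity. *)
Lemma toric_swap_involution l :
  involution (toric false (fun=> true) id l) ->
  forall j, l false j * l true j = 1.
Proof.
move=> inv; set z := zmap false id l.
have z1 := @ord_zmap C p false id l.
have lz b j : fcomp (l b j) z * l (~~ b) j = 1.
  have := toric_inj (etrans (esym (toric_comp _ _ _ _ _ _ _ _))
    (etrans inv (idmapE C p))) b j.
  by rewrite addbT.
have ll0 j : l false j 0%MM * l true j 0%MM = 1.
  have := congr1 (fun F : fps C p => F 0%MM) (lz false j).
  by rewrite fpsM0 fcomp_at0 // fps1 eqxx.
pose Z := FMap false z; pose W := FMap false (fun k => 2^-1 *: (fX k + z k)).
have zE k : z k = l false k * l true k * fX k by [].
have zz k : fcomp (z k) z = fX k.
  rewrite [z k in LHS]zE !fcompM // fcomp_fX // zE.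
  have := lz false k; have := lz true k; rewrite /= => e1 e2.
  have -> : fcomp (l false k) z * fcomp (l true k) z *
      (l false k * l true k * fX k) =
      (fcomp (l false k) z * l true k) * (fcomp (l true k) z * l false k) * fX k.
    by ring.
  by rewrite e1 e2 !mul1r.
have W1 i : ord 1 (comps W i) by apply/ordZ/ordD => //; apply: ord_fX.
have dW : diag_part (fun=> 1) W.
  move=> k /=; rewrite scale1r.
  have -> : 2^-1 *: (fX k + z k) - fX k = 2^-1 *: (z k - fX k).
    have half2 (F : fps C p) : F = 2^-1 *: (F + F).
      by rewrite -mulr2n -scaler_nat scalerA mulVf ?scale1r ?pnatr_eq0.
    by rewrite [X in _ - X](half2 (fX k)) -scalerBr; congr (_ *: _); ring.
  apply: ordZ; rewrite zE -[X in _ - X]mul1r -mulrBl.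
  apply: (@ordM _ _ 1 1); last exact: ord_fX.
  by apply/ord1E; rewrite fpsD fpsN fps1 fpsM0 ll0 eqxx subrr.
have WZ : mcomp W Z = W.
  apply: fmapP => // k; rewrite comps_mcomp /= fcompZ fcompD fcomp_fX //.
  by rewrite zz addrC.
have [|W' [[_ [W0 W'0] _ W'W] _]] := inverse_theorem (erefl : antihol W = false) dW.
  by move=> i; apply: oner_neq0.
have Z0 : fixes0 Z by move=> k; apply/ord1E/z1.
have Zid : Z = idmap C p by rewrite -[Z]mcomp_idl // -W'W -mcompA // WZ.
move=> j; apply: (@mulfX_inj C p j); rewrite mul1r.
by have := congr1 (fun f : fmap C p => comps f j) Zid.
Qed.

Lemma mul1_unit (F G : fps C p) : F * G = 1 -> F \is a GRing.unit /\ G = F^-1.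
Proof.
move=> e; have uF : F \is a GRing.unit.
  apply/eqP => F0; have /eqP := congr1 (fun H : fps C p => H 0%MM) e.
  by rewrite fpsM0 F0 mul0r fps1 eqxx eq_sym oner_eq0.
by split=> //; apply: (mulrI uF); rewrite e mulrV.
Qed.

(** An involution reversing [N] intertwines [N] with [N^-1], so that rigidity
    fixes its shape. *)
Lemma reversor_tau mu (N X : fmap C (p + p)) :
  (forall k, mu k != 0) -> nonresonant mu ->
  antihol N = false -> diag_part (ext mu) N ->
  equivariant (ext mu) (ext mu) (comps N) ->
  antihol X = false -> fixes0 X -> involution X ->
  mcomp N (mcomp X N) = X ->
  exists2 L : 'I_p -> fps C p, forall j, L j \is a GRing.unit & X = tau_nf L.
Proof.
move=> mu0 nr aN dN eN aX X0 iX NXN.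
have e0 i : ext mu i != 0.
  by elim/idx_ind: i => b j; rewrite extE; case: b; rewrite ?invr_eq0.
have [N' [iN dN']] := inverse_theorem aN dN e0.
have eN' := equivariant_inv (equivariant_inverse iN eN).
have [[_ aN'] [N0 N'0] _ N'N] := iN.
have XN : mcomp X N = mcomp N' X.
  rewrite -[in RHS]NXN mcompA //; last exact: fixes0_mcomp.
  by rewrite N'N mcomp_idl //; exact: fixes0_mcomp.
have eX : equivariant (ext mu) (fun i => (ext mu i)^-1) (comps X).
  apply: rigidity eN eN' _ => // [i|i|i].
  - by rewrite invr_eq0.
  - exact: ord1_fixes0.
  - have := congr1 (fun f : fmap C _ => comps f i) XN.
    by rewrite !comps_mcomp aX aN'.
have [|l Xl] := toric_of_equivariant (sw := fun=> true) (pi := id) mu0 nr _ eX.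
  by move=> b j; rewrite !extE addbT; case: b; rewrite ?invrK.
rewrite aX in Xl; rewrite Xl in iX *.
have ll := toric_swap_involution iX.
exists (l false) => [j|]; first by case: (mul1_unit (ll j)).
rewrite tau_nfE; apply: eq_toric => // b j.
by case: b => //; case: (mul1_unit (ll j)).
Qed.

(** An anti-holomorphic involution with the same combinatorics as its linear
    model is conjugate to it by an averaging: [D + rho_1 D rho] intertwines
    [rho] and [rho_1], where the diagonal matrix [D] is chosen so that the
    linear part of the average is invertible. *)
Lemma linearize_antihol (sw : 'I_p -> bool) (pi : 'I_p -> 'I_p) c :
  (forall j, sw (pi j) = sw j) -> (forall j, pi (pi j) = j) ->
  involution (toric true sw pi c) ->
  exists2 g : bool -> 'I_p -> fps C p, forall b j, g b j 0%MM != 0 &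
    mcomp (toric true sw pi (fun _ _ => 1)) (toric false (fun=> false) id g) =
    mcomp (toric false (fun=> false) id g) (toric true sw pi c).
Proof.
move=> swpi pipi inv.
have z1 := @ord_zmap C p true pi c.
have cc b j : fcomp (c b j) (zmap true pi c) * fconj (c (b (+) sw j) (pi j)) = 1.
  move: inv; rewrite /involution toric_comp idmapE => inv.
  have e := etrans _ inv.
  apply: (toric_inj (c := fun b j => fcomp (c b j) (zmap true pi c) *
    fconj (c (b (+) sw j) (pi j))) (c' := fun _ _ => 1) (e _ _)).
  by apply: eq_toric => // k; rewrite ?swpi ?addbb ?pipi.
pose c0 b j := c b j 0%MM.
have cc0 b j : c0 b j * (c0 (b (+) sw j) (pi j))^* = 1.
  have := congr1 (fun F : fps C p => F 0%MM) (cc b j).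
  by rewrite fpsM0 fcomp_at0 // fps1 eqxx.
(* The linear part of the average is [d + conj d' / c0], which vanishes for
   [d = d' = 1] exactly when [c0 = -1]. *)
pose d b j : C := if c0 b j == -1 then 'i else 1.
pose g b j : fps C p := d b j *: 1 +
  (d (b (+) sw j) (pi j))^* *: fconj (c (b (+) sw j) (pi j)).
exists g => [b j|].
  rewrite fpsD !fpsZ fps1 eqxx mulr1 /= -/(c0 _ _) /d.
  set c1 := c0 _ (pi j); have e := cc0 b j; rewrite -/c1 in e.
  case: (eqVneq (c0 b j) (-1)) => [c1e|ne].
    have -> : c1 = -1.
      move: e; rewrite c1e mulN1r => /eqP; rewrite eqr_oppLR => /eqP e.
      by rewrite -[c1]conjCK e rmorphN1.
    by rewrite eqxx conjCi rmorphN1 mulrN1 opprK -mulr2n mulrn_eq0 neq0Ci.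
  case: (c1 =P -1) => [c1e|_].
    by move: e ne; rewrite c1e rmorphN1 mulrN1 => /eqP; rewrite eqr_oppLR => ->.
  rewrite rmorph1 mul1r addrC addr_eq0; apply: contraNneq ne => c1e.
  by move: e; rewrite c1e mulrN1 => /eqP; rewrite eqr_oppLR.
rewrite !toric_comp; apply: eq_toric => // [j|b j] /=; first by rewrite addbF.
rewrite fcomp1 ?mul1r; last by move=> k; apply: ord_zmap.
rewrite addbF /g fcompD !fcompZ fcomp1; last by move=> k; apply: ord_zmap.
rewrite fconjD !fconjZ fconj1 conjCK fconjK swpi pipi addbK.
rewrite mulrDl -!scalerAl mul1r addrC; congr (_ + _ *: _).
have := congr1 (@fconj _ _) (cc (b (+) sw j) (pi j)).
rewrite fconjM fconj_fcomp fconjK fconj1 swpi pipi addbK => <-.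
congr (_ * _); apply: fcomp_eqr => k.
by rewrite /zmap /= fconjM fconjK fconj_fX.
Qed.

Lemma equivariant_toric mu c : (forall k, mu k != 0) ->
  equivariant (ext mu) (ext mu) (comps (toric false (fun=> false) id c)).
Proof.
move=> mu0; apply/equivariantP; apply: idx_ind => b j.
have D1 i := ord_diagm (ext mu) i.
rewrite comps_toric addbF fcompM // fcomp_fX // fcomp_at_xieta //.
rewrite /diagm -scalerAr; congr (_ *: (_ * _)); apply: fcomp_eqr => k.
by rewrite !extE -scalerAl -scalerAr scalerA mulfV ?scale1r.
Qed.

End Reversible.

Section Labels.
Variables (C : numClosedFieldType) (es hs ss : nat).
Local Notation p := (es + hs + (ss + ss))%N.
Implicit Types (j : 'I_p) (mu lambda : 'I_p -> C).

Lemma swap_s_id j : (j < es + hs)%N -> swap_s j = j.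
Proof. by move=> lt; rewrite /swap_s; case: splitP => // k e; rewrite e ltnNge leq_addr in lt. Qed.

Lemma swap_s_l (s : 'I_ss) :
  swap_s (rshift (es + hs) (lshift ss s)) = rshift (es + hs) (rshift ss s).
Proof.
rewrite /swap_s -/(unsplit (inr (lshift ss s))) unsplitK.
by rewrite -/(unsplit (inl s)) unsplitK.
Qed.

Lemma swap_s_r (s : 'I_ss) :
  swap_s (rshift (es + hs) (rshift ss s)) = rshift (es + hs) (lshift ss s).
Proof.
rewrite /swap_s -/(unsplit (inr (rshift ss s))) unsplitK.
by rewrite -/(unsplit (inr s)) unsplitK.
Qed.

Lemma index_ind (P : 'I_p -> Prop) :
  (forall j, (j < es + hs)%N -> P j) ->
  (forall s : 'I_ss, P (rshift (es + hs) (lshift ss s))) ->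
  (forall s : 'I_ss, P (rshift (es + hs) (rshift ss s))) -> forall j, P j.
Proof.
move=> h1 h2 h3 j; have [lt|le] := ltnP j (es + hs); first exact: h1.
case: (splitP j) => k e; first by rewrite e leqNgt ltn_ord in le.
have -> : j = rshift (es + hs) k by apply: val_inj.
case: (splitP k) => s es'; [have -> : k = lshift ss s | have -> : k = rshift ss s];
  by [apply: val_inj|apply: h2|apply: h3].
Qed.

Lemma swap_sK j : swap_s (swap_s j) = j.
Proof.
elim/index_ind: j => [j lt|s|s]; first by rewrite !swap_s_id.
  by rewrite swap_s_l swap_s_r.
by rewrite swap_s_r swap_s_l.
Qed.

Lemma ltn_rshift_es (k : 'I_(ss + ss)) : (rshift (es + hs) k < es)%N = false.
Proof. by rewrite /= ltnNge -addnA leq_addr. Qed.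

Lemma swap_s_lt j : (swap_s j < es)%N = (j < es)%N.
Proof.
elim/index_ind: j => [j lt|s|s]; first by rewrite swap_s_id.
  by rewrite swap_s_l !ltn_rshift_es.
by rewrite swap_s_r !ltn_rshift_es.
Qed.

Lemma swap_s_es j : (j < es)%N -> swap_s j = j.
Proof. by move=> lt; rewrite swap_s_id // ltn_addr. Qed.

Lemma rho_stdE : rho_std es hs ss =
  toric true (fun j => (j < es)%N) (@swap_s es hs ss) (fun _ _ => 1 : fps C p).
Proof.
apply: fmap_idxP => // b j; rewrite comps_toric at_xieta1 mul1r /=.
have := idxK b j; rewrite /unidx.
by case: (split _) => k [<- <-] /=; case: ifP => // lt; rewrite swap_s_es.
Qed.

(** The conjugate of an eigenvalue is, up to inversion, an eigenvalue; this is
    where the index permutation of the standard involution comes from. *)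
Lemma label_conj lambda : eigen_labels (fun j => lambda j ^+ 2) lambda ->
  forall j, lambda j != 0 /\
    (lambda j)^* = if (j < es)%N then lambda j else (lambda (swap_s j))^-1.
Proof.
move=> [_ le lh ls lss]; elim/index_ind => [j lt|s|s].
- have [jes|jes] := ltnP j es.
    have l1 := le j jes; have l0 : 0 < lambda j by apply: lt_trans l1.
    by rewrite gt_eqF // geC0_conj // ltW.
  have n1 : `|lambda j| = 1 by apply: lh; rewrite jes.
  have l0 : lambda j != 0 by rewrite -normr_eq0 n1 oner_eq0.
  by rewrite swap_s_id // invC_norm n1 expr1n invr1 mul1r.
- set j := rshift _ _; set t := rshift (es + hs) (rshift ss s).
  have js : (es + hs <= j < es + hs + ss)%N by rewrite /= leq_addr ltn_add2l ltn_ord.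
  have l1 := ls j js.
  have l0 : lambda j != 0 by rewrite -normr_eq0 gt_eqF // (lt_trans _ l1).
  split=> //; rewrite ltn_rshift_es swap_s_l (lss j t) ?invrK //=.
  by rewrite -[RHS]addnA [(s + ss)%N]addnC.
- set t := rshift _ _; set j := rshift (es + hs) (lshift ss s).
  have js : (es + hs <= j < es + hs + ss)%N by rewrite /= leq_addr ltn_add2l ltn_ord.
  have l1 := ls j js.
  have l0 : lambda j != 0 by rewrite -normr_eq0 gt_eqF // (lt_trans _ l1).
  have tE : lambda t = ((lambda j)^*)^-1.
    by apply: lss => //=; rewrite -[RHS]addnA [(s + ss)%N]addnC.
  rewrite tE invr_eq0 conjC_eq0; split=> //.
  rewrite ltn_rshift_es swap_s_r -/j -[in RHS](conjCK (lambda j)).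
  exact: fmorphV.
Qed.

Lemma eigen_conj mu lambda : eigen_labels mu lambda ->
  forall j, mu j != 0 /\
    (mu j)^* = if (j < es)%N then mu j else (mu (swap_s j))^-1.
Proof.
move=> lab; have muE : mu = fun j => lambda j ^+ 2.
  by case: lab => h _ _ _ _; apply: funext.
rewrite muE in lab *; move=> j; have [l0 lc] := label_conj lab j.
split; first by rewrite expf_eq0.
by rewrite rmorphXn /= lc; case: ifP; rewrite ?exprVn.
Qed.

(** The normalizing map is the one of Poincare-Dulac followed by the inverse of
    an average; the latter commutes with the linear part of [sigma], and
    therefore preserves the first normalization. *)
Theorem normal_form_exists mu lambda (sigma tau1 tau2 rho0 : fmap C (p + p)) :
  eigen_labels mu lambda -> nonresonant mu ->
  antihol sigma = false -> fixes0 sigma ->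
  linear_part (comps sigma) = linS mu ->
  antihol tau1 = false -> fixes0 tau1 -> involution tau1 ->
  antihol rho0 = true -> fixes0 rho0 -> involution rho0 ->
  tau2 = mcomp rho0 (mcomp tau1 rho0) -> sigma = mcomp tau1 tau2 ->
  exists Psi M L1 L2, normal_form mu sigma tau1 tau2 rho0 Psi M L1 L2.
Proof.
move=> lab nr as_ s0 lin at1 t10 it1 ar r0 ir t2E sE.
have muc := eigen_conj lab; have mu0 j : mu j != 0 by case: (muc j).
have e0 i : ext mu i != 0.
  by elim/idx_ind: i => b j; rewrite extE; case: b; rewrite ?invr_eq0.
have trt0 : fixes0 (mcomp rho0 (mcomp tau1 rho0)) by do !apply: fixes0_mcomp.
have tr0 : fixes0 (mcomp tau1 rho0) by apply: fixes0_mcomp.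
have rr g : fixes0 g -> mcomp rho0 (mcomp rho0 g) = g.
  by move=> g0; apply: involution_cancel.
have tt g : fixes0 g -> mcomp tau1 (mcomp tau1 g) = g.
  by move=> g0; apply: involution_cancel.
have t20 : fixes0 tau2 by rewrite t2E.
have at2 : antihol tau2 = false by rewrite t2E /= at1 ar.
have it2 : involution tau2.
  by rewrite /involution t2E -!mcompA // rr // tt.
(* [sigma] is conjugate to its inverse by each of [tau1], [tau2], [rho0]; the
   form [sigma f sigma = f] avoids mentioning the inverse. *)
have st1s : mcomp sigma (mcomp tau1 sigma) = tau1.
  by rewrite sE tt // -mcompA // it2 mcomp_idr.
have st2s : mcomp sigma (mcomp tau2 sigma) = tau2.
  have t12 : fixes0 (mcomp tau1 tau2) by apply: fixes0_mcomp.
  rewrite sE -mcompA //; last exact: fixes0_mcomp.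
  by rewrite (involution_cancel t20 t12 it2) tt.
have srs : mcomp sigma (mcomp rho0 sigma) = rho0.
  have g1 : fixes0 (mcomp tau1 (mcomp rho0 (mcomp tau1 rho0))) by apply: fixes0_mcomp.
  have g2 := fixes0_mcomp r0 g1.
  by rewrite sE t2E -!mcompA // rr // tt // rr // tt.
have ds := diag_part_linS s0 lin.
have [Psi0 [N [[aP0 aN] dP0 dN eN sP0]]] := poincare_dulac as_ ds.
have [|Psi0' [iP0 _]] := inverse_theorem aP0 dP0; first by move=> i; apply: oner_neq0.
have N0 := diag_part_fixes0 dN.
have cs : cnj Psi0 Psi0' sigma = N.
  by case: iP0 => _ [P0 P'0] _ PP; rewrite /cnj sP0 mcompA // PP mcomp_idl.
have cP f : fixes0 f -> mcomp sigma (mcomp f sigma) = f ->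
    mcomp N (mcomp (cnj Psi0 Psi0' f) N) = cnj Psi0 Psi0' f.
  move=> f0 h; rewrite -cs -!(cnjM iP0) ?h //; exact: fixes0_mcomp.
pose rho1 := cnj Psi0 Psi0' rho0.
have r1 : fixes0 rho1 by apply: (cnj_fixes0 iP0).
have ar1 : antihol rho1 = true by rewrite (cnj_antihol iP0).
have ir1 : involution rho1 by apply: (cnj_involution iP0).
(* [rho1 N = N^-1 rho1] involves the conjugate of [N], because the variables
   are conjugated in [rho1]. Thus it is [conj S] that is paired with [S^-1]. *)
have [N' [iN dN']] := inverse_theorem aN dN e0.
have eN' := equivariant_inv (equivariant_inverse iN eN).
have [[_ aN'] [_ N'0] _ N'N] := iN.
have rN : mcomp rho1 N = mcomp N' rho1.
  have rN0 : fixes0 (mcomp rho1 N) by apply: fixes0_mcomp.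
  by rewrite -[rho1 in RHS](cP _ r0 srs) mcompA // N'N mcomp_idl.
have er : equivariant (fun i => (ext mu i)^*) (fun i => (ext mu i)^-1) (comps rho1).
  apply: rigidity (diag_part_conj dN) dN' (equivariant_conj eN) eN' _.
  - by move=> i; rewrite invr_eq0.
  - exact: ord1_fixes0.
  - move=> i; have := congr1 (fun f : fmap C _ => comps f i) rN.
    by rewrite !comps_mcomp ar1 aN'.
pose muc' j := (mu j)^*.
have extc : (fun i => (ext mu i)^*) = ext muc'.
  apply: funext; apply: idx_ind => b j; rewrite !extE.
  by case: b => //; rewrite fmorphV.
rewrite extc in er.
have [||b j|c rc] := @toric_of_equivariant _ _ muc' _ (fun j : 'I_p => (j < es)%N)
  (@swap_s es hs ss) _ _ _ _ er.
- by move=> k; rewrite conjC_eq0.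
- move=> Q /nr; apply: contra => /eqP h; apply/eqP.
  rewrite -[LHS]conjCK rmorph_prod -[RHS]conjCK rmorph1; congr (_^*).
  rewrite -[RHS]h; apply: eq_bigr => k _; exact: fmorphXz.
- rewrite !extE /muc'; have [_ mc] := muc (swap_s j).
  rewrite mc swap_s_lt swap_sK; case jes: (j < es)%N.
    by rewrite addbT swap_s_es //; case: b; rewrite ?invrK.
  by rewrite addbF; case: b; rewrite ?invrK.
rewrite ar1 in rc.
have [g g0 Gr] : exists2 g : bool -> 'I_p -> fps C p,
    forall b j, g b j 0%MM != 0 &
    mcomp (rho_std es hs ss) (toric false (fun=> false) id g) =
    mcomp (toric false (fun=> false) id g) rho1.
  rewrite rho_stdE rc; apply: linearize_antihol => [j|j|]; last by rewrite -rc.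
    exact: swap_s_lt.
  exact: swap_sK.
set G := toric _ _ _ g in Gr.
pose d i := g (unidx i).1 (unidx i).2 0%MM.
have dG : diag_part d G by apply: diag_part_toric => b j; rewrite /d idxK.
have d0 i : d i != 0 by apply: g0.
have [G' [iG dG']] := inverse_theorem (erefl : antihol G = false) dG d0.
have iG' := inverse_maps_sym iG.
have G0 := diag_part_fixes0 dG; have G'0 := diag_part_fixes0 dG'.
have [[aG aG'] _ GG' G'G] := iG.
pose N1 := cnj G' G N.
have P00 := diag_part_fixes0 dP0.
have P0'0 : fixes0 Psi0' by case: iP0 => _ [].
pose Psi := mcomp Psi0 G'; pose Psi' := mcomp G Psi0'.
have iPsi : inverse_maps Psi Psi' by apply: inverse_maps_comp.
have cnj2 f : fixes0 f -> mcomp Psi' (mcomp f Psi) = cnj G' G (cnj Psi0 Psi0' f).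
  move=> f0; have fP0 : fixes0 (mcomp f Psi0) by apply: fixes0_mcomp.
  have PG0 : fixes0 (mcomp Psi0 G') by apply: fixes0_mcomp.
  by rewrite /Psi /Psi' /cnj -!mcompA //; apply: fixes0_mcomp.
have sN1 : mcomp Psi' (mcomp sigma Psi) = N1 by rewrite cnj2 // cs.
have aN1 : antihol N1 = false by rewrite (cnj_antihol iG').
have N10 : fixes0 N1 by apply: (cnj_fixes0 iG').
have NG' : antihol (mcomp N G') = false by rewrite /= aN aG'.
have dN1 : diag_part (ext mu) N1.
  have := diag_part_comp aG dG (diag_part_comp aN dN dG').
  congr diag_part; apply: funext => i.
  by rewrite mulrCA mulfV ?mulr1.
have eG : equivariant (ext mu) (ext mu) (comps G) by apply: equivariant_toric.
have eG' := equivariant_inverse iG eG.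
have eN1 : equivariant (ext mu) (ext mu) (comps N1).
  apply: equivariant_comp => //; first exact: fixes0_mcomp.
  exact: equivariant_comp.
have tauP f : antihol f = false -> fixes0 f -> involution f ->
    mcomp sigma (mcomp f sigma) = f ->
    exists2 L : 'I_p -> fps C p, forall j, L j \is a GRing.unit &
      mcomp Psi' (mcomp f Psi) = tau_nf L.
  move=> af f0 iF h; rewrite cnj2 //; set f1 := cnj Psi0 _ _.
  have f10 : fixes0 f1 by apply: (cnj_fixes0 iP0).
  apply: (reversor_tau mu0 nr aN1 dN1 eN1).
  - by rewrite (cnj_antihol iG') (cnj_antihol iP0).
  - exact: (cnj_fixes0 iG').
  - by apply: (cnj_involution iG') => //; apply: (cnj_involution iP0).
  - rewrite -!(cnjM iG') //; last exact: fixes0_mcomp.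
    by rewrite /f1 cP.
have [L1 uL1 t1L] := tauP _ at1 t10 it1 st1s.
have [L2 uL2 t2L] := tauP _ at2 t20 it2 st2s.
have sL : N1 = mcomp (tau_nf L1) (tau_nf L2).
  have h : cnj Psi Psi' sigma = N1 by [].
  by rewrite -h sE (cnjM iPsi) // -t1L -t2L.
rewrite !tau_nfE toric_comp in sL.
pose M j := L1 j * (L2 j)^-1.
have N1M : N1 = sigma_nf M.
  rewrite sL sigma_nfE; apply: eq_toric => // b j.
  set z := zmap _ _ _.
  have -> : z = fX.
    by apply: funext => k; rewrite /z /zmap /= mulrV // mul1r.
  rewrite fcomp_id addbT /M; case: b => //=.
  by rewrite invrM ?unitrV // invrK mulrC.
exists Psi, M, L1, L2; split; first last.
- move=> j; split=> //; rewrite N1M sigma_nfE in dN1.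
  by have := toric_at0 dN1 false j; rewrite extE.
- by exists Psi'.
- by exists Psi'.
- by exists Psi'; rewrite sN1.
- exists Psi'; split=> //; rewrite cnj2 // -/rho1 /cnj mcompA //.
  rewrite -Gr -mcompA // GG' mcomp_idr //.
Qed.

End Labels.

(** * Reduction of the normal form *)

Section Reality.
Variables (C : numClosedFieldType) (p : nat) (pi : 'I_p -> 'I_p).
Hypothesis piK : forall j, pi (pi j) = j.
Implicit Types (F G : fps C p).

(** The involution induced on functions of the invariants by an anti-holomorphic
    involution acting on them by [zeta_j |-> conj zeta_(pi j)]. *)
Definition rc F : fps C p := fcomp (fconj F) (fun k => fX (pi k)).

Let X1 k : ord 1 (fX (pi k) : fps C p). Proof. exact: ord_fX. Qed.

Lemma rcM F G : rc (F * G) = rc F * rc G.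
Proof. by rewrite /rc fconjM fcompM. Qed.

Lemma rcD F G : rc (F + G) = rc F + rc G.
Proof. by rewrite /rc fconjD fcompD. Qed.

Lemma rcN F : rc (- F) = - rc F.
Proof. by rewrite /rc fconjN fcompN. Qed.

Lemma rcB F G : rc (F - G) = rc F - rc G.
Proof. by rewrite rcD rcN. Qed.

Lemma rcZ a F : rc (a *: F) = a^* *: rc F.
Proof. by rewrite /rc fconjZ fcompZ. Qed.

Lemma rc1 : rc 1 = 1.
Proof. by rewrite /rc fconj1 fcomp1. Qed.

Lemma rcX F k : rc (F ^+ k) = rc F ^+ k.
Proof. by rewrite /rc fconjX fcompX. Qed.

Lemma rc_fX j : rc (fX j) = fX (pi j).
Proof. by rewrite /rc fconj_fX fcomp_fX. Qed.

Lemma rc_at0 F : rc F 0%MM = (F 0%MM)^*.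
Proof. by rewrite fcomp_at0. Qed.

Lemma rc_unit F : (rc F \is a GRing.unit) = (F \is a GRing.unit).
Proof. by rewrite !funitE rc_at0 conjC_eq0. Qed.

Lemma rcK F : rc (rc F) = F.
Proof.
rewrite /rc fconj_fcomp fconjK fcompA //; last by move=> k; apply/ord_fconj.
rewrite -[RHS]fcomp_id; apply: fcomp_eqr => k.
by rewrite fconj_fX fcomp_fX // piK.
Qed.

Lemma ord_rc d F : ord d F -> ord d (rc F).
Proof. by move=> h; apply: ord_fcomp => //; apply: ord_fconj. Qed.

Lemma rc_fcomp F (G : 'I_p -> fps C p) : (forall k, ord 1 (G k)) ->
  rc (fcomp F G) = fcomp (rc F) (fun k => rc (G (pi k))).
Proof.
move=> G1; have rG k : ord 1 (rc (G (pi k))) by apply: ord_rc.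
rewrite /rc fconj_fcomp !fcompA //; last by move=> k; apply: ord_fconj.
by apply: fcomp_eqr => k; rewrite fcomp_fX // piK.
Qed.

Lemma fcomp_perm F m :
  fcomp F (fun k => fX (pi k)) m = F [multinom m (pi i) | i < p].
Proof.
have pi_inj : injective pi by move=> i j e; rewrite -(piK i) e piK.
have prodE (k : 'X_{1..p}) :
    \prod_i fX (pi i) ^+ k i = fmon C [multinom k (pi i) | i < p].
  rewrite -fX_monomial (reindex_inj pi_inj); apply: eq_bigr => i _.
  by rewrite piK mnmE.
have permK (k : 'X_{1..p}) :
    [multinom [multinom k (pi i) | i < p] (pi i) | i < p] = k.
  by apply/mnmP => i; rewrite !mnmE piK.
have lt : (mdeg [multinom m (pi i) | i < p] < (mdeg m).+1)%N.
  rewrite ltnS !mdegE [leqRHS](reindex_inj pi_inj).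
  by apply: leq_sum => i _; rewrite mnmE.
rewrite /= (bigD1 (BMultinom lt)) //= prodE permK /= eqxx mulr1.
rewrite big1 ?addr0 // => k; rewrite -val_eqE /= => km.
rewrite prodE /=; case: eqP => [e|]; last by rewrite mulr0.
by case/eqP: km; have := congr1 (fun k : 'X_{1..p} =>
  [multinom k (pi i) | i < p]) e; rewrite permK => ->.
Qed.

Lemma rc_coef F m : rc F m = (F [multinom m (pi i) | i < p])^*.
Proof. exact: fcomp_perm. Qed.

Definition divpart (j : 'I_p) F : fps C p :=
  FPS (fun m => if m j == 0%N then 0 else F m).

Lemma divpartE j F m : divpart j F m = if m j == 0%N then 0 else F m.
Proof. by []. Qed.

Lemma rc_divpart j F : rc (divpart j F) = divpart (pi j) (rc F).
Proof.
apply: fpsP => m; rewrite rc_coef.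
rewrite -[RHS]/(if m (pi j) == 0%N then 0 else rc F m) rc_coef /= mnmE.
by case: ifP => _; rewrite ?rmorph0.
Qed.

End Reality.

Section Flattening.
Variables (C : numClosedFieldType) (p : nat) (g : 'I_p -> fps C p).
Hypothesis g2 : forall j, ord 2 (g j).
Implicit Types (w : 'I_p -> fps C p).

(** Its fixed points are the families [w], with [w_j] divisible by [zeta_j],
    such that the [j]-th component of [(zeta + g) o (zeta + w) - zeta] has no
    monomial divisible by [zeta_j]. *)
Definition flatten_step w j : fps C p :=
  - divpart j (fcomp (g j) (fun k => fX k + w k)).

Lemma ord_fXD w : (forall j, ord 2 (w j)) -> forall k, ord 1 (fX k + w k).
Proof.
by move=> w2 k; apply: ordD; [exact: ord_fX|apply: (@ordW _ _ 2)].
Qed.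

Lemma ord_divpart d j (F : fps C p) : ord d F -> ord d (divpart j F).
Proof. by move=> h m md /=; rewrite h // if_same. Qed.

Lemma flatten_contraction : contraction 2 flatten_step.
Proof.
split=> [w w2 j m md|e w w' w2 w2' ww j m md].
  rewrite fpsN (@ord_divpart 2) ?oppr0 //.
  by apply: ord_fcomp => //; apply: ord_fXD.
rewrite !fpsN /=; congr (- _); case: ifP => // _.
apply: (@fcomp_close _ _ _ 2 (1 + e)) md => // k.
by split; [exact: ord_fXD|exact: ord_fXD|apply: eqdD].
Qed.

(** Both [w] and [0] are fixed points, since [g] is already flat. *)
Lemma flatten_unique w : (forall j, ord 2 (w j)) ->
  (forall j, divpart j (g j) = 0) -> (forall j, divpart j (w j) = w j) ->
  (forall j, divpart j (w j + fcomp (g j) (fun k => fX k + w k)) = 0) ->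
  w = fun=> 0.
Proof.
move=> w2 gd wd h; apply: (contraction_unique flatten_contraction) => //.
  apply: funext => j; rewrite /flatten_step; apply/eqP; rewrite eq_sym -addr_eq0.
  rewrite -[X in X + _]wd -(h j); apply/eqP/fpsP => m; rewrite fpsD /=.
  by case: ifP; rewrite ?addr0.
apply: funext => j; rewrite /flatten_step.
have -> : (fun k => fX k + 0) = fX :> ('I_p -> fps C p).
  by apply: funext => k; rewrite addr0.
by rewrite fcomp_id gd oppr0.
Qed.

End Flattening.

Section LogMap.
Variables (C : numClosedFieldType) (es hs ss : nat).
Local Notation p := (es + hs + (ss + ss))%N.
Local Notation rc := (@rc C p (@swap_s es hs ss)).
Implicit Types (F : fps C p) (M : 'I_p -> fps C p).

Lemma normalized_at0 F : F 0%MM != 0 ->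
  ((F 0%MM)^-1 *: F) 0%MM = 1.
Proof. by move=> F0; rewrite fpsZ mulVf. Qed.

Lemma log_map_fcomp M (G : 'I_p -> fps C p) j : (forall k, ord 1 (G k)) ->
  M j 0%MM != 0 ->
  log_map (fun j => fcomp (M j) G) j = fcomp (log_map M j) G.
Proof.
move=> G1 M0; rewrite /log_map fcomp_at0 // -fcompZ.
rewrite -flog_fcomp ?normalized_at0 //.
by case: ifP => // _; rewrite fcompZ.
Qed.

Lemma rc_flog F : F 0%MM = 1 -> rc (flog F) = flog (rc F).
Proof.
move=> F0; rewrite /rc flog_conj flog_fcomp //; last by rewrite /= F0 rmorph1.
by move=> k; apply: ord_fX.
Qed.

(** Where [rho] does not exchange [xi] and [eta], it inverts [M]; the factor
    [-i] of the logarithm makes up for this sign. *)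
Lemma rc_log_map M :
  (forall j, M j 0%MM != 0) ->
  (forall j, rc (M j) = if (j < es)%N then M j else (M (swap_s j))^-1) ->
  forall j, rc (log_map M j) = log_map M (swap_s j).
Proof.
move=> M0 rM j; have U0 k := normalized_at0 (M0 k).
have rU : rc ((M j 0%MM)^-1 *: M j) = ((M j 0%MM)^-1)^* *: rc (M j) by apply: rcZ.
have c0 : ((M j 0%MM)^-1)^* = (rc (M j) 0%MM)^-1 by rewrite rc_at0 fmorphV.
rewrite c0 rM in rU; rewrite /log_map swap_s_lt.
case: ifP rU => jes rU; first by rewrite (rc_flog (U0 j)) rU swap_s_es.
rewrite rcZ (rc_flog (U0 j)) rU.
have uM : M (swap_s j) \is a GRing.unit by rewrite funitE.
have -> : ((M (swap_s j))^-1 0%MM)^-1 *: (M (swap_s j))^-1 =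
    ((M (swap_s j) 0%MM)^-1 *: M (swap_s j))^-1.
  by rewrite (fpsV0 uM) invrZ // unitfE invr_eq0.
rewrite (flogV (U0 _)) scalerN -scaleNr; congr (_ *: _).
by rewrite rmorphN /= conjCi opprK.
Qed.

End LogMap.

Section Reduction.
Variables (C : numClosedFieldType) (es hs ss : nat).
Local Notation p := (es + hs + (ss + ss))%N.
Local Notation swp := (@swap_s es hs ss).
Local Notation rc := (@rc C p swp).
Local Notation X1 := (@ord_fX C p).
Implicit Types (M L : 'I_p -> fps C p) (mu : 'I_p -> C).

Definition recip_pair L (b : bool) (j : 'I_p) : fps C p :=
  if b then (L j)^-1 else L j.

Let sw (j : 'I_p) := (j < es)%N.

Lemma fixes0_sigma_nf L : fixes0 (sigma_nf L : fmap C (p + p)).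
Proof. by rewrite sigma_nfE; apply: fixes0_toric. Qed.

Lemma fixes0_tau_nf L : fixes0 (tau_nf L : fmap C (p + p)).
Proof. by rewrite tau_nfE; apply: fixes0_toric. Qed.

Lemma fixes0_rho_std : fixes0 (rho_std es hs ss : fmap C (p + p)).
Proof. by rewrite rho_stdE; apply: fixes0_toric. Qed.

Lemma recip_pair_unit L : (forall j, L j \is a GRing.unit) ->
  forall b j, recip_pair L b j \is a GRing.unit.
Proof. by move=> uL b j; rewrite /recip_pair; case: b; rewrite ?unitrV. Qed.

Lemma recip_pairK L : (forall j, L j \is a GRing.unit) ->
  forall b j, recip_pair L b j * recip_pair L (~~ b) j = 1.
Proof. by move=> uL b j; rewrite /recip_pair; case: b; rewrite /= ?mulVr ?mulrV. Qed.

Lemma zmap_recip_pair L : (forall j, L j \is a GRing.unit) ->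
  zmap false id (recip_pair L) = fX.
Proof.
by move=> uL; apply: funext => k; rewrite /zmap /= (recip_pairK uL false) mul1r.
Qed.

Lemma tau_nf_conj L1 L2 :
  tau_nf L2 = mcomp (rho_std es hs ss) (mcomp (tau_nf L1) (rho_std es hs ss)) ->
  forall b j, recip_pair L2 b j = rc (recip_pair L1 (b (+) sw j) (swp j)).
Proof.
rewrite !rho_stdE !tau_nfE !toric_comp => e b j.
have z1 k : zmap false swp (fun _ _ => 1) k = fX (swp k) :> fps C p.
  by rewrite /zmap /= mul1r mul1r.
have := etrans e (eq_toric (sw' := fun=> true) (pi' := id)
  (c' := fun b j => rc (recip_pair L1 (b (+) sw j) (swp j))) false _ _ _).
move=> h; apply: (toric_inj (h _ _ _)) => {b j} [j|j|b j] /=.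
- by rewrite swap_s_lt -/(sw j); case: (sw j).
- exact: swap_sK.
- rewrite fcomp1 ?mul1r; last by move=> k; apply: ord_zmap.
  rewrite mulr1 /rc fconj_fcomp; apply: fcomp_eqr => k.
  by rewrite z1 fconj_fX.
Qed.

Lemma sigma_nf_prod M L1 L2 : (forall j, L2 j \is a GRing.unit) ->
  sigma_nf M = mcomp (tau_nf L1) (tau_nf L2) ->
  forall b j, recip_pair M b j = recip_pair L1 b j * recip_pair L2 (~~ b) j.
Proof.
move=> uL2; rewrite sigma_nfE !tau_nfE toric_comp => e b j.
rewrite -/(recip_pair L1) -/(recip_pair L2) in e.
have := toric_inj e b j; rewrite -/(recip_pair M b j) => ->.
by rewrite (zmap_recip_pair uL2) fcomp_id addbT.
Qed.

Lemma tangent_ord2 (F : 'I_p -> fps C p) : tangent_to_id F ->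
  forall j, ord 2 (F j - fX j).
Proof.
move=> [F0 lin] j; rewrite -[fX j]scale1r.
apply: (diag_part_linear (d := fun=> 1) (f := FMap false F)) => // i k.
by rewrite lin mxE.
Qed.

Lemma sqrt_unit (F : fps C p) : F \is a GRing.unit ->
  exists2 S, S ^+ 2 = F & S \is a GRing.unit.
Proof.
move=> uF; have F0 : F 0%MM != 0 by [].
have [S S2 _] := sqrt_exists (sqrtCK (F 0%MM)) F0.
by exists S => //; rewrite -(unitrX_pos _ (n := 2)) // S2.
Qed.

Lemma root4_unit (F : fps C p) : F \is a GRing.unit ->
  exists2 S, S ^+ 4 = F & S \is a GRing.unit.
Proof.
move=> /sqrt_unit [S <- /sqrt_unit [T <- uT]].
by exists T => //; rewrite -exprM.
Qed.

(** The change of invariants [phi = zeta + w = y zeta] flattens [log M]. It is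
    lifted to the coordinates by coefficients [G] with [G_j G'_j = y_j] that
    are exchanged by [rho]; the symmetric expression [t t^rho s], with
    [t^4 = Lambda_1 o phi] and [s^2 = y], satisfies this and moreover
    [G^4 = (Lambda_1 Lambda_2 o phi) y^2], which makes the product of the two
    new [Lambda] equal to one. *)
Theorem reduced_form_exists mu M L1 L2 :
  (forall j, mu j != 0) -> (forall j, M j 0%MM = mu j) ->
  (forall j, L1 j \is a GRing.unit) -> (forall j, L2 j \is a GRing.unit) ->
  tau_nf L2 = mcomp (rho_std es hs ss) (mcomp (tau_nf L1) (rho_std es hs ss)) ->
  sigma_nf M = mcomp (tau_nf L1) (tau_nf L2) ->
  tangent_to_id (log_map M) ->
  exists Phi Mh Lh1 Lh2, reduced_form mu M L1 L2 Phi Mh Lh1 Lh2.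
Proof.
move=> mu0 M0 uL1 uL2 t2 sE /tangent_ord2 g2.
have L12 := tau_nf_conj t2; have MLL := sigma_nf_prod uL2 sE.
have swsw j : sw (swp j) = sw j by apply: swap_s_lt.
have R1 b j : rc (recip_pair L1 b j) = recip_pair L2 (b (+) sw j) (swp j).
  by rewrite L12 swsw addbK swap_sK.
have R2 b j : rc (recip_pair L2 b j) = recip_pair L1 (b (+) sw j) (swp j).
  by rewrite L12 rcK //; exact: swap_sK.
have M0' j : M j 0%MM != 0 by rewrite M0.
have uM j : M j \is a GRing.unit by apply: M0'.
have rM j : rc (M j) = if (j < es)%N then M j else (M (swp j))^-1.
  have -> : rc (M j) = recip_pair M (~~ sw j) (swp j).
    by rewrite -[M j]/(recip_pair M false j) MLL rcM R1 R2 MLL negbK mulrC.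
  by rewrite /sw /recip_pair; case: ltnP => // jes; rewrite swap_s_es.
have rF := rc_log_map M0' rM.
pose F := log_map M; pose g j := F j - fX j.
have [w [w2 Tw]] := contraction_fixpoint (flatten_contraction g2).
pose phi k := fX k + w k.
have phi1 := ord_fXD w2 : forall k, ord 1 (phi k).
have wE j : w j = - divpart j (fcomp (g j) phi) by rewrite -[in LHS]Tw.
have rg j : rc (g j) = g (swp j) by rewrite rcB rF rc_fX.
(* The flattening map commutes with the involution, by uniqueness. *)
pose w' j := rc (w (swp j)).
have rphi' k : rc (phi (swp k)) = fX k + w' k by rewrite rcD rc_fX swap_sK.
have ww' : w' = w.
  apply: (contraction_unique (flatten_contraction g2)) => // [j|].
    by apply: ord_rc.
  apply: funext => j; rewrite /flatten_step /w' wE rcN; congr (- _).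
  rewrite (rc_divpart (@swap_sK es hs ss)) swap_sK; congr (divpart _ _).
  rewrite (rc_fcomp (@swap_sK es hs ss)) // rg swap_sK.
  by apply: fcomp_eqr => k; rewrite rphi'.
have rphi k : rc (phi k) = phi (swp k).
  by rewrite -[in LHS](swap_sK k) rphi' ww'.
pose y j : fps C p := 1 + FPS (fun m => w j (m + U_(j))%MM).
have phiE j : phi j = y j * fX j.
  rewrite mulrDl mul1r; congr (_ + _); apply: fpsP => m.
  have [mj|mj] := eqVneq (m j) 0%N.
    by rewrite mulfX_coef0 // wE fpsN /= mj eqxx oppr0.
  have em : m = (m - U_(j) + U_(j))%MM by rewrite submK // lep1mP.
  by rewrite [in RHS]em mulfX_coef /= -em.
have y0 j : y j 0%MM = 1.
  by rewrite fpsD fps1 eqxx /= add0m w2 ?mdeg1 // addr0.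
have ry j : rc (y j) = y (swp j).
  apply: (@mulfX_inj C p (swp j)); rewrite -phiE -rphi phiE rcM rc_fX //.
have s_ex j : exists S, S ^+ 2 = y j /\ S 0%MM = 1.
  have [||S S2 S0] := @sqrt_exists C p (y j) 1; rewrite ?y0 ?expr1n ?oner_neq0 //.
  by exists S.
have [s sP] := choice s_ex.
have s2 j : s j ^+ 2 = y j by case: (sP j).
have s0 j : s j 0%MM = 1 by case: (sP j).
have rs j : rc (s j) = s (swp j).
  apply: sqrt_unique; rewrite ?rc_at0 ?s0 ?rmorph1 ?oner_neq0 //.
  by rewrite -rcX !s2.
have uLphi b j : fcomp (recip_pair L1 b j) phi \is a GRing.unit.
  by rewrite funitE fcomp_at0 // -funitE recip_pair_unit.
have t_ex j : exists S, S ^+ 4 = fcomp (L1 j) phi /\ S \is a GRing.unit.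
  by have [S S4 uS] := root4_unit (uLphi false j); exists S.
have [t tP] := choice t_ex.
have ut j : t j \is a GRing.unit by case: (tP j).
have t4 b j : recip_pair t b j ^+ 4 = fcomp (recip_pair L1 b j) phi.
  rewrite /recip_pair; case: b; rewrite ?exprVn; case: (tP j) => -> _ //.
  by rewrite fcompV.
have us j : s j \is a GRing.unit by apply: funit1.
(* The second factor is the image under [rho] of the root at the partner
   index. *)
pose G b j := recip_pair t b j * rc (recip_pair t (b (+) sw j) (swp j)) * s j.
have GG j : G false j * G true j = y j.
  rewrite -s2 /G.
  have -> : recip_pair t false j * rc (recip_pair t (false (+) sw j) (swp j)) * s j *
     (recip_pair t true j * rc (recip_pair t (true (+) sw j) (swp j)) * s j) =
     (recip_pair t false j * recip_pair t true j) *
     (rc (recip_pair t (sw j) (swp j)) * rc (recip_pair t (~~ sw j) (swp j))) * s j ^+ 2 by ring.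
  by rewrite -rcM !(recip_pairK ut) rc1 !mul1r.
have rG b j : rc (G b j) = G (b (+) sw j) (swp j).
  rewrite /G !rcM rcK; last exact: swap_sK.
  by rewrite rs swsw addbK swap_sK [rc _ * _]mulrC.
have uG b j : G b j \is a GRing.unit.
  by rewrite /G !unitrM us rc_unit !recip_pair_unit.
have G4 b j : G b j ^+ 4 = fcomp (recip_pair L1 b j) phi * fcomp (recip_pair L2 b j) phi * y j ^+ 2.
  rewrite /G !exprMn t4 -rcX t4 -s2 -exprM; congr (_ * _ * _).
  rewrite (rc_fcomp (@swap_sK es hs ss)) // R1 swsw addbK swap_sK.
  by apply: fcomp_eqr => k; rewrite rphi swap_sK.
clearbody G.
pose Phi := toric false (fun=> false) id G.
have zG : zmap false id G = phi.
  by apply: funext => k; rewrite /zmap /= GG phiE.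
pose d i := G (unidx i).1 (unidx i).2 0%MM.
have dPhi : diag_part d Phi by apply: diag_part_toric => b j; rewrite /d idxK.
have [|Phi' [iPhi _]] := inverse_theorem (erefl : antihol Phi = false) dPhi.
  by move=> i; rewrite /d -funitE.
pose Mh j := fcomp (M j) phi.
pose Lh1 j := fcomp (L1 j) phi * G true j * (G false j)^-1.
pose Lh2 j := (Lh1 j)^-1.
have uMh j : Mh j \is a GRing.unit by rewrite funitE fcomp_at0.
have uLh1 j : Lh1 j \is a GRing.unit.
  by rewrite /Lh1 unitrMr ?unitrV ?uG // unitrMr ?uG //; apply: (uLphi false).
have uLh2 j : Lh2 j \is a GRing.unit by rewrite unitrV.
have inv2 L j : (forall j, L j \is a GRing.unit) ->
    fcomp (recip_pair L true j) phi * fcomp (recip_pair L false j) phi = 1.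
  by move=> uL; rewrite -fcompM // (recip_pairK uL true) fcomp1.
have GL j : fcomp (L1 j) phi * fcomp (L2 j) phi * G true j ^+ 2 = G false j ^+ 2.
  apply: (mulrI (unitrX 2 (uG false j))); rewrite -exprD (G4 false j) -GG.
  by rewrite exprMn /recip_pair; ring.
have tauC L Lh : (forall j, Lh j \is a GRing.unit) ->
    (forall b j, fcomp (recip_pair L b j) phi * G (~~ b) j = G b j * recip_pair Lh b j) ->
    conjugates Phi (tau_nf L) (tau_nf Lh).
  move=> uLh h; apply: (conjugates_intro iPhi) => [||]; [exact: fixes0_tau_nf|exact: fixes0_tau_nf|].
  rewrite !tau_nfE !toric_comp; apply: eq_toric => // b j.
  by rewrite -/(recip_pair L b j) -/(recip_pair Lh) zG (zmap_recip_pair uLh) fcomp_id addbT h addbF.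
exists Phi, Mh, Lh1, Lh2; split=> //; first split.
- apply: (conjugates_intro iPhi); [exact: fixes0_rho_std|exact: fixes0_rho_std|].
  rewrite rho_stdE !toric_comp.
  apply: eq_toric => // [j|b j] /=; first by rewrite addbF.
  rewrite fcomp1 ?mul1r; last by move=> k; apply: ord_zmap.
  rewrite mulr1 -/(sw j) -rG /rc fconj_fcomp fconjK.
  apply: fcomp_eqr => k.
  by rewrite /zmap /= fconj_fX !mul1r.
- apply: (conjugates_intro iPhi); [exact: fixes0_sigma_nf|exact: fixes0_sigma_nf|].
  rewrite !sigma_nfE !toric_comp.
  apply: eq_toric => // b j; rewrite -/(recip_pair M b j) -/(recip_pair Mh) zG (zmap_recip_pair uMh).
  rewrite fcomp_id addbF mulrC /=; congr (_ * _).
  by rewrite /recip_pair; case: (b) => //; rewrite fcompV.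
- apply: tauC => // -[] j; last first.
    by rewrite /= /Lh1 mulrC [RHS]mulrC divrK // mulrC.
  apply: (mulIr (uLh1 j)); rewrite -[RHS]mulrA mulVr // mulr1 /Lh1.
  rewrite [LHS](_ : _ = (fcomp (recip_pair L1 true j) phi * fcomp (recip_pair L1 false j) phi)
    * (G false j * (G false j)^-1) * G true j) /=; last by rewrite /=; ring.
  by rewrite (inv2 L1) // mulrV // !mul1r.
- apply: tauC => // -[] j; apply: (mulIr (uG false j)).
    rewrite /= invrK /Lh1 -[RHS]mulrA divrK //.
    have := congr1 (fun F => fcomp (recip_pair L2 true j) phi * F) (GL j).
    rewrite [X in X = _ -> _](_ : _ = (fcomp (recip_pair L2 true j) phi *
      fcomp (recip_pair L2 false j) phi) * (fcomp (L1 j) phi * G true j ^+ 2)).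
      by rewrite (inv2 L2) // mul1r => e; rewrite -mulrA -expr2 -e; ring.
    by rewrite /=; ring.
  apply: (mulIr (uLh1 j)).
  have -> : G false j * recip_pair Lh2 false j * G false j * Lh1 j =
      ((Lh1 j)^-1 * Lh1 j) * G false j ^+ 2 by rewrite /recip_pair /Lh2; ring.
  rewrite mulVr // mul1r /Lh1 -GL.
  rewrite [LHS](_ : _ = fcomp (L2 j) phi * fcomp (L1 j) phi * G true j ^+ 2 *
    (G false j * (G false j)^-1)); last by rewrite /=; ring.
  by rewrite mulrV // mulr1 [fcomp (L2 j) _ * _]mulrC.
- by move=> j; rewrite /Mh fcomp_at0 // M0.
move=> j; have -> : log_map Mh j - fX j = w j + fcomp (g j) phi.
  rewrite (log_map_fcomp phi1) // fcompB fcomp_fX // /phi; ring.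
have gj2 : ord 2 (fcomp (g j) phi) by apply: ord_fcomp; [exact: phi1|exact: g2].
split=> m h; first by rewrite fpsD w2 // gj2 // addr0.
by rewrite fpsD wE fpsN /= (negPf h) addNr.
Qed.

End Reduction.

(** * Uniqueness of the reduced normal form *)

Section Uniqueness.
Variables (C : numClosedFieldType) (es hs ss : nat).
Local Notation p := (es + hs + (ss + ss))%N.
Implicit Types (M L : 'I_p -> fps C p) (mu : 'I_p -> C)
  (Theta : fmap C (p + p)).

Lemma ext_neq0 mu i : (forall j, mu j != 0) -> ext mu i != 0.
Proof.
by move=> mu0; elim/idx_ind: i => b j; rewrite extE; case: b; rewrite ?invr_eq0.
Qed.

Lemma diag_part_sigma_nf mu M : (forall j, mu j != 0) ->
  (forall j, M j 0%MM = mu j) -> diag_part (ext mu) (sigma_nf M).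
Proof.
move=> mu0 M0; rewrite sigma_nfE; apply: diag_part_toric => b j.
by rewrite extE; case: b; rewrite ?fpsV0 ?funitE M0.
Qed.

Lemma intertwiner_toric mu M M' Theta :
  (forall j, mu j != 0) -> nonresonant mu ->
  (forall j, M j 0%MM = mu j) -> (forall j, M' j 0%MM = mu j) ->
  antihol Theta = false -> fixes0 Theta ->
  mcomp Theta (sigma_nf M') = mcomp (sigma_nf M) Theta ->
  exists g, Theta = toric false (fun=> false) id g.
Proof.
move=> mu0 nr M0 M'0 aT T0 e.
have e0 i : ext mu i != 0 by apply: ext_neq0.
have eqT : equivariant (ext mu) (ext mu) (comps Theta).
  apply: (rigidity (F := comps (sigma_nf M')) (G := comps (sigma_nf M)) e0
    (ord1_fixes0 T0) (diag_part_sigma_nf mu0 M'0)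
    (diag_part_sigma_nf mu0 M0)).
  - by rewrite sigma_nfE; apply: equivariant_toric.
  - by rewrite sigma_nfE; apply: equivariant_toric.
  - move=> i; have := congr1 (fun f : fmap C _ => comps f i) e.
    by rewrite !comps_mcomp aT.
have [|g gE] := toric_of_equivariant (sw := fun=> false) (pi := id) mu0 nr _ eqT.
  by move=> b j; rewrite addbF.
by exists g; rewrite gE aT.
Qed.

(** Two reduced forms conjugate to each other are related by a change of the
    invariants [zeta |-> zeta + w], with [w_j] divisible by [zeta_j]; both the
    identity and this map then flatten [log M], hence they agree. *)
Theorem reduced_unique mu M M' Theta Theta' :
  (forall j, mu j != 0) -> nonresonant mu ->
  (forall j, M j 0%MM = mu j) -> (forall j, M' j 0%MM = mu j) ->
  log_reduced M -> log_reduced M' ->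
  inverse_maps Theta Theta' ->
  mcomp (sigma_nf M) Theta = mcomp Theta (sigma_nf M') -> M = M'.
Proof.
move=> mu0 nr M0 M'0 rM rM' iT e.
have [[aT aT'] [T0 T'0] TT' T'T] := iT.
have f0 := @fixes0_sigma_nf C es hs ss.
have [g gE] := intertwiner_toric mu0 nr M0 M'0 aT T0 (esym e).
have e' : mcomp Theta' (sigma_nf M) = mcomp (sigma_nf M') Theta'.
  have h0 : fixes0 (mcomp (sigma_nf M) Theta) by apply: fixes0_mcomp.
  have h1 : fixes0 (mcomp (sigma_nf M') Theta') by apply: fixes0_mcomp.
  rewrite -[RHS]mcomp_idl // -T'T -mcompA // [mcomp Theta (mcomp _ _)]mcompA //.
  by rewrite -e -mcompA // TT' mcomp_idr.
have [g' gE'] := intertwiner_toric mu0 nr M'0 M0 aT' T'0 e'.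
have ug b j : g b j \is a GRing.unit.
  have := T'T; rewrite gE gE' toric_comp idmapE => h.
  have := toric_inj h b j; rewrite addbF mulrC => /mul1_unit [] //.
pose phi := zmap false id g.
have phi1 k : ord 1 (phi k) by apply: ord_zmap.
have uM' j : M' j \is a GRing.unit by rewrite funitE M'0.
have MM' j : fcomp (M j) phi = M' j.
  move: e; rewrite gE !sigma_nfE !toric_comp => h.
  have := toric_inj h false j; rewrite -/phi.
  have -> : zmap false id (fun (b : bool) j => if b then (M' j)^-1 else M' j) = fX.
    exact: zmap_recip_pair uM'.
  by rewrite fcomp_id mulrC => /(mulrI (ug _ _)).
pose f j := log_map M j - fX j; pose w j := phi j - fX j.
have f2 j : ord 2 (f j) by case: (rM j).
have M0' j : M j 0%MM != 0 by rewrite M0.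
have logE0 j : log_map M' j = fcomp (log_map M j) phi.
  have -> : M' = fun j => fcomp (M j) phi by apply: funext => k; rewrite MM'.
  exact: (log_map_fcomp phi1 (M0' j)).
have logE j : log_map M' j = phi j + fcomp (f j) phi.
  rewrite logE0; have -> : log_map M j = f j + fX j by rewrite subrK.
  by rewrite fcompD (fcomp_fX phi1) addrC.
have fX_phi : (fun k => fX k + w k) = phi.
  by apply: funext => k; rewrite addrC subrK.
have wE j : w j + fcomp (f j) phi = log_map M' j - fX j.
  by rewrite logE /w; ring.
have w2 j : ord 2 (w j).
  have -> : w j = (log_map M' j - fX j) - fcomp (f j) phi by rewrite -wE addrK.
  by apply: ordB; [case: (rM' j)|apply: ord_fcomp].
have w0 : w = fun=> 0.
  have red (F : fps C p) j : (forall m : 'X_{1..p}, m j != 0%N -> F m = 0) -> divpart j F = 0.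
    by move=> F0; apply: fpsP => m; rewrite divpartE; case: eqVneq => // /F0.
  apply: (flatten_unique f2 w2) => j.
  - by apply: red; case: (rM j).
  - have -> : w j = (g false j * g true j - 1) * fX j by rewrite mulrBl mul1r.
    apply: fpsP => m; rewrite divpartE.
    by case: eqP => // mj; rewrite mulfX_coef0.
  - by rewrite fX_phi wE; apply: red; case: (rM' j).
apply: funext => j; rewrite -MM' -[LHS]fcomp_id; apply: fcomp_eqr => k.
by have := congr1 (fun v : 'I_p -> fps C p => v k) w0 => /subr0_eq ->.
Qed.

Section Relations.
Variables (mu : 'I_p -> C) (sigma tau1 tau2 rho0 : fmap C (p + p)).
Hypotheses (s0 : fixes0 sigma) (t10 : fixes0 tau1) (r0 : fixes0 rho0).

Lemma normal_form_relations Psi M L1 L2 :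
  normal_form mu sigma tau1 tau2 rho0 Psi M L1 L2 ->
  tau2 = mcomp rho0 (mcomp tau1 rho0) -> sigma = mcomp tau1 tau2 ->
  tau_nf L2 = mcomp (rho_std es hs ss) (mcomp (tau_nf L1) (rho_std es hs ss)) /\
  sigma_nf M = mcomp (tau_nf L1) (tau_nf L2).
Proof.
move=> [cr cs c1 c2 _] t2E sE; have [Psi' [iP _]] := cr.
have t1r := fixes0_mcomp t10 r0.
have t20 : fixes0 tau2 by rewrite t2E; apply: fixes0_mcomp.
rewrite -(cnj_eq iP c2) -(cnj_eq iP cs) -(cnj_eq iP c1) -(cnj_eq iP cr).
rewrite -!/(cnj Psi Psi' _) -(cnjM iP t10 t20) -(cnjM iP t10 r0).
by rewrite -(cnjM iP r0 t1r) -t2E -sE.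
Qed.

Lemma reduced_from_conjugate Mh : reduced_from mu sigma tau1 tau2 rho0 Mh ->
  [/\ log_reduced Mh, forall j, Mh j 0%MM = mu j &
   exists F F', inverse_maps F F' /\ mcomp sigma F = mcomp F (sigma_nf Mh)].
Proof.
move=> [Psi [M [L1 [L2 [Phi [Lh1 [Lh2 [[_ cs _ _ _] _ [[_ ch _ _ hM] _ red]]]]]]]]].
split; [exact: red|by move=> j; case: (hM j)|].
have [Psi' [iP _]] := cs; have [Phi' [iF _]] := ch.
exists (mcomp Psi Phi), (mcomp Phi' Psi'); split; first exact: inverse_maps_comp.
have [[_ _] [P0 _] _ _] := iP; have [[_ _] [F0 _] _ _] := iF.
have sn := @fixes0_sigma_nf C es hs ss.
rewrite (mcompA _ P0 F0) (conjugates_elim s0 cs) -(mcompA _ (sn _) F0).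
by rewrite (conjugates_elim (sn _) ch) (mcompA _ F0 (sn _)).
Qed.

Lemma reduced_from_unique Mh Mh' :
  (forall j, mu j != 0) -> nonresonant mu ->
  reduced_from mu sigma tau1 tau2 rho0 Mh ->
  reduced_from mu sigma tau1 tau2 rho0 Mh' -> Mh = Mh'.
Proof.
move=> mu0 nr /reduced_from_conjugate [rM M0 [F [F' [iF sF]]]].
move=> /reduced_from_conjugate [rM' M'0 [H [H' [iH sH]]]].
apply: (reduced_unique mu0 nr M0 M'0 rM rM'
  (inverse_maps_comp (inverse_maps_sym iF) iH)).
have [_ [F0 F'0] FF' F'F] := iF; have [_ [H0 H'0] HH' H'H] := iH.
have sn := @fixes0_sigma_nf C es hs ss.
have F'H := fixes0_mcomp F'0 H0.
have sF' : mcomp F' sigma = mcomp (sigma_nf Mh) F'.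
  rewrite -[mcomp F' sigma]mcomp_idr -FF' (mcompA _ F0 F'0).
  by rewrite -(mcompA _ s0 F0) sF (mcompA _ F0 (sn _)) F'F (mcomp_idl (sn _)).
rewrite (mcompA _ F'0 H0) -sF' -(mcompA _ s0 H0) sH.
exact: (mcompA _ H0 (sn _)).
Qed.

End Relations.

End Uniqueness.

(** * Normal form, reduction and uniqueness for the germ [sigma] *)

Theorem theorem1p2 (R : realType) (es hs ss : nat)
  (mu lambda : 'I_(es + hs + (ss + ss)) -> R[i])
  (sigma tau1 tau2 rho0 :
     fmap R[i] (es + hs + (ss + ss) + (es + hs + (ss + ss)))) :
  eigen_labels mu lambda ->
  nonresonant mu ->
  hol_germ sigma ->
  linear_part (comps sigma) = linS mu ->
  hol_germ tau1 -> involution tau1 ->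
  antihol_germ rho0 -> involution rho0 ->
  tau2 = mcomp rho0 (mcomp tau1 rho0) ->
  sigma = mcomp tau1 tau2 ->
  [/\ exists Psi M L1 L2, normal_form mu sigma tau1 tau2 rho0 Psi M L1 L2,
      forall Psi M L1 L2,
        normal_form mu sigma tau1 tau2 rho0 Psi M L1 L2 ->
        tangent_to_id (log_map M) ->
        exists Phi Mh Lh1 Lh2, reduced_form mu M L1 L2 Phi Mh Lh1 Lh2
    & forall Mh Mh',
        reduced_from mu sigma tau1 tau2 rho0 Mh ->
        reduced_from mu sigma tau1 tau2 rho0 Mh' -> Mh = Mh'].
Proof.
move=> lab nr [as_ s0 _] lin [at1 t10 _] it1 [ar r0 _] ir t2E sE.
have mu0 j : mu j != 0 by case: (eigen_conj lab j).
split.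
- exact: (normal_form_exists lab nr as_ s0 lin at1 t10 it1 ar r0 ir t2E sE).
- move=> Psi M L1 L2 nf tan.
  have [t2n sn] := normal_form_relations t10 r0 nf t2E sE.
  have [_ _ _ _ hM] := nf.
  apply: (reduced_form_exists mu0 _ _ _ t2n sn tan);
    by move=> j; case: (hM j).
- by move=> Mh Mh'; apply: (reduced_from_unique s0 mu0 nr).
Qed.
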